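(* Let $\phi:C'\to C$ be a finite morphism between smooth projective irreducible $k$-curves such that $k(C)\hookrightarrow k(C')$ is Galois, and let $\psi,\psi'$ be the compatible deformation retractions described in the context. Let $p \in C^{\mathrm{an}}$ be a point which is not of type IV. Then $$n_p = [k(C') : k(C)]\,/\,\big(c_{r_p}(x)\,\mathrm{ram}(x)\big)$$ for any $x \in C(k)$ such that $\psi(r_p,x) = p$.
   Context: $k$ is an algebraically closed field, complete with respect to a non-trivial non-Archimedean absolute value $|\cdot|$, with residue field $\tilde k$. $C^{\mathrm{an}}$ denotes the Berkovich analytification. Points of $C^{\mathrm{an}}$ are of type I ($k$-points), II (residue field of the completed residue field $\mathcal{H}(x)$ has transcendence degree 1 over $\tilde k$), III ($|\mathcal{H}(x)^*|/|k^*|$ of rank 1), IV (all others). Discs, annuli, skeleta. For $a\in k$, $r \ge 0$, $\eta_{a,r}\in \mathbb{A}^{1,\mathrm{an}}_k$ is the sup-seminorm on the closed disc of center $a$, radius $r$ ($\eta_{a,0}=a$). For $r, r_1<r_2$ in $|k^*|$: the standard open disc is $\mathbf{O}(0,r)=\{|T|<r\}$, the standard open annulus is $\{r_1<|T|<r_2\}$, the standard punctured open disc is $\mathbf{O}(0,r)\smallsetminus\{0\}$. The skeleton of a standard open annulus or punctured disc $A$ is the set of points $\eta_{0,s}$, $s>0$, in $A$, transported by any isomorphism to spaces isomorphic to $A$. For $C$ smooth projective irreducible, a weak semistable vertex set in $C^{\mathrm{an}}$ is a finite set $\mathfrak{W}$ of points of type I or II such that all but finitely many connected components of $C^{\mathrm{an}}\smallsetminus\mathfrak{W}$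 are isomorphic to the standard open unit disc and the remaining finitely many are each isomorphic to a standard open annulus or a standard punctured open unit disc. Its skeleton $\Sigma(C^{\mathrm{an}},\mathfrak{W})$ is the union of $\mathfrak{W}$ and the skeleta of these annuli and punctured discs. The retractions $\psi,\psi'$. Choose a finite separable morphism $a:C\to\mathbb{P}^1_k$, a finite Galois extension $K$ of $k(\mathbb{P}^1_k)$ containing $k(C')$, let $C''$ be the smooth projective curve with function field $K$ and $c:C''\to C'\to C\to\mathbb{P}^1_k$ the composite. Choose a weak semistable vertex set $\mathfrak{A}$ of $\mathbb{P}^{1,\mathrm{an}}_k$ containing the points over which $c$ is ramified, such that the inverse images of $\mathfrak{A}$ in $C^{\mathrm{an}},C'^{\mathrm{an}},C''^{\mathrm{an}}$ are weak semistable vertex sets whose skeleta are the inverse images of $\Sigma:=\Sigma(\mathbb{P}^{1,\mathrm{an}}_k,\mathfrak{A})$. Let $\lambda$ be the following deformation retraction of $\mathbb{P}^{1,\mathrm{an}}_k$ onto $\Sigma$: points of $\Sigma$ are fixed; each connected component $D$ of the complement of $\Sigma$ is identified with the open unit disc by a fixed isomorphism $\rho_D$, and for $p\in D$, if $u(p)\in[0,1)$ is the infimum of the radii of closed subdiscs of $D$ containing $p$, then $\lambda(t,p)=p$ for $t\le u(p)$, $\lambda(t,p)=\rho_D^{-1}(\eta_{x,t})$ for $u(p)<t<1$, where the closed disc of center $x$ and radius $t$ is the unique closed disc of radius $t$ containing $\rho_D(p)$, and $\lambda(1,p)$ is the unique boundary point of $D$. Each path $\lambda(\cdot,c^{\mathrm{an}}(q))$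 has a unique lift to $C''^{\mathrm{an}}$ starting at $q$; these lifts form a $\mathrm{Gal}(K/k(\mathbb{P}^1_k))$-equivariant deformation retraction of $C''^{\mathrm{an}}$, which induces deformation retractions $\psi'$ of $C'^{\mathrm{an}}$ and $\psi$ of $C^{\mathrm{an}}$, compatible with $\phi^{\mathrm{an}}$ ($\phi^{\mathrm{an}}(\psi'(t,q))=\psi(t,\phi^{\mathrm{an}}(q))$). The image $\psi(1,C^{\mathrm{an}})$ contains all points of $C(k)$ over which $\phi$ is ramified. Invariants. $n_p=\mathrm{card}\,(\phi^{\mathrm{an}})^{-1}(p)$. For $p\in C^{\mathrm{an}}$ not of type IV, $r_p$ is the smallest $r\in[0,1]$ such that $p\in\psi(r,C(k))=\{\psi(r,x):x\in C(k)\}$ (if there is no such $r$, there is no $x$ as in the claim and the claim is vacuous). For $x\in C(k)$, $\mathrm{ram}(x)$ is the ramification index of $O_{C,x}\hookrightarrow O_{C',x'}$ for any $x'\in\phi^{-1}(x)$ (independent of $x'$). For $r\in[0,1]$ and $x\in C(k)$, $c_r(x)$ is the number of $y'\in C'(k)$ with $\phi(y')=x$ and $\psi'(r,y')=\psi'(r,x')$, for any $x'\in\phi^{-1}(x)$ (independent of the choice of $x'$). *)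

(* Defs.v *)
From HB Require Import structures.
From mathcomp Require Import all_boot all_order all_algebra all_field.
From mathcomp Require Import all_classical all_reals all_analysis.
From mathcomp Require Import finmap ring.
Set Implicit Arguments.
Unset Strict Implicit.
Unset Printing Implicit Defensive.
Import Order.TTheory GRing.Theory Num.Theory.
Import numFieldNormedType.Exports.
Local Open Scope classical_set_scope.
Local Open Scope ring_scope.

(** Smooth projective irreducible curves over [k] are given by their function
    fields: [k(C)/k] is finitely generated of transcendence degree 1, the
    scheme points of [C] are the valuation rings of [k(C)/k] (the trivial one
    is the generic point), and the local ring [O_{C,x}] is the valuation ring
    [x] itself.  A finite morphism [C' -> C] is a [k]-embedding
    [k(C) -> k(C')]. *)

Section ValuedFields.
Context {R : realType}.

Definition is_absolute_value (L : fieldType) (v : L -> R) : Prop :=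
  [/\ forall x, 0 <= v x,
      forall x, v x = 0 <-> x = 0,
      forall x y, v (x * y) = v x * v y &
      forall x y, v (x + y) <= Num.max (v x) (v y)].

Definition complete_for (L : fieldType) (v : L -> R) : Prop :=
  forall u : nat -> L,
    (forall e, 0 < e -> exists N : nat, forall m n : nat,
       (N <= m)%N -> (N <= n)%N -> v (u m - u n) < e) ->
    exists l, forall e, 0 < e -> exists N : nat, forall n : nat,
      (N <= n)%N -> v (u n - l) < e.

Definition nontrivial_complete (k : fieldType) (abs : k -> R) : Prop :=
  [/\ is_absolute_value abs,
      exists c, c != 0 /\ abs c != 1 &
      complete_for abs].

End ValuedFields.

(** ** Curves and morphisms *)

Section Curves.
Variable k : closedFieldType.

(** [f] is in the span of [s] over [k(t)]; the common denominator is [Q]. *)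
Definition spanned (F : fieldType) (iota : {rmorphism k -> F}) (t : F)
    (s : seq F) (f : F) : Prop :=
  exists (Q : {poly k}) (P : 'I_(size s) -> {poly k}), Q != 0 /\
    f * (map_poly iota Q).[t]
      = \sum_(i < size s) (map_poly iota (P i)).[t] * s`_i.

Definition function_field (F : fieldType) (iota : {rmorphism k -> F}) : Prop :=
  exists2 t : F,
    (forall P : {poly k}, P != 0 -> (map_poly iota P).[t] != 0) &
    exists s : seq F, forall f : F, spanned iota t s f.

Structure curve := Curve {
  funfield :> fieldType;
  cst : {rmorphism k -> funfield};
  curveP : function_field cst
}.

Record curve_mor (X' X : curve) := CurveMor {
  pullback :> {rmorphism X -> X'};
  pullback_cst : forall c, pullback (cst X c) = cst X' c
}.

Definition comp_mor (X'' X' X : curve)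
    (g : curve_mor X' X) (h : curve_mor X'' X') : curve_mor X'' X :=
  @CurveMor X'' X (h \o g)
    (fun c => etrans (congr1 h (pullback_cst g c)) (pullback_cst h c)).

Definition P1_field : fieldType := {fraction {poly k}}.
Definition P1_poly (P : {poly k}) : P1_field := FracField.tofrac P.
Definition P1_cst : {rmorphism k -> P1_field} :=
  @FracField.tofrac {poly k} \o @polyC k.

Lemma P1_horner (P : {poly k}) :
  (map_poly P1_cst P).[P1_poly 'X] = P1_poly P.
Proof.
rewrite /P1_cst /P1_poly -[in RHS](comp_polyXr P) /comp_poly.
by rewrite -horner_map /= -map_poly_comp.
Qed.

Lemma P1_function_field : function_field P1_cst.
Proof.
exists (P1_poly 'X) => [P P0|]; first by rewrite P1_horner tofrac_eq0.
exists [:: 1] => f; elim/quotW: f => x.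
exists (frac x).2, (fun=> (frac x).1); split; first exact: denom_ratioP.
rewrite big_ord1 /= !P1_horner mulr1 /P1_poly.
unlock FracField.tofrac; rewrite -[LHS]FracField.pi_mul.
apply/eqmodP; rewrite /= FracField.equivfE /FracField.mulf.
rewrite !numden_Ratio ?oner_neq0 ?mulr1 ?denom_ratioP //.
by rewrite mulrC.
Qed.

Definition P1 : curve := Curve P1_function_field.

(** The curve of a finite extension [L] of [k(X)], as a covering of [X]. *)
Definition cover_cst (X : curve) (L : fieldExtType X) : {rmorphism k -> L} :=
  in_alg L \o cst X.

Lemma spanned0 F iota t s : @spanned F iota t s 0.
Proof.
exists 1, (fun=> 0); split; first exact: oner_neq0.
by rewrite mul0r big1 // => i _; rewrite rmorph0 horner0 mul0r.
Qed.

Lemma spannedD F iota t s f g :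
  @spanned F iota t s f -> spanned iota t s g -> spanned iota t s (f + g).
Proof.
move=> [Q [P [Q0 E]]] [Q' [P' [Q'0 E']]].
exists (Q * Q'), (fun i => P i * Q' + P' i * Q); split; first exact: mulf_neq0.
rewrite rmorphM hornerM mulrDl mulrA E [_.[t] * _.[t]]mulrC mulrA E'.
rewrite !mulr_suml -big_split; apply: eq_bigr => i _ /=.
by rewrite rmorphD !rmorphM hornerD !hornerM; ring.
Qed.

Lemma spanned_poly F iota t s f (P : {poly k}) :
  @spanned F iota t s f -> spanned iota t s ((map_poly iota P).[t] * f).
Proof.
move=> [Q [P' [Q0 E]]]; exists Q, (fun i => P * P' i); split=> //.
rewrite -mulrA E mulr_sumr; apply: eq_bigr => i _.
by rewrite rmorphM hornerM mulrA.
Qed.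

Lemma spanned_div F iota t s f (P : {poly k}) : P != 0 ->
  @spanned F iota t s ((map_poly iota P).[t] * f) -> spanned iota t s f.
Proof.
move=> P0 [Q [P' [Q0 E]]]; exists (P * Q), P'; split; first exact: mulf_neq0.
by rewrite -E rmorphM hornerM mulrA [f * _]mulrC.
Qed.

Lemma spanned_mem F iota t s f : f \in s -> @spanned F iota t s f.
Proof.
move=> fs; have fi : (index f s < size s)%N by rewrite index_mem.
exists 1, (fun i => if i == Ordinal fi then 1 else 0).
split; first exact: oner_neq0.
rewrite (bigD1 (Ordinal fi)) //= eqxx big1 ?addr0 => [|i /negPf ->].
  by rewrite rmorph1 hornerC mulr1 mul1r nth_index.
by rewrite rmorph0 horner0 mul0r.
Qed.

Lemma cover_function_field (X : curve) (L : fieldExtType X) :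
  function_field (cover_cst L).
Proof.
have [t tP [s sP]] := curveP X; set io := cover_cst L.
set iota := cst X in tP sP.
have ioE P : (map_poly io P).[t%:A] = (map_poly iota P).[t]%:A.
  rewrite /io /cover_cst /= map_poly_comp.
  by rewrite -[t%:A]/(in_alg L t) horner_map.
exists t%:A => [P P0|]; first by rewrite ioE scaler_eq0 negb_or tP // oner_neq0.
exists [seq x%:A * y | x <- s, y <- vbasis {:L}%VS] => f.
rewrite [f](coord_vbasis (memvf f)).
elim/big_ind: _ => [|g h|j _]; [exact: spanned0 | exact: spannedD |].
case: (sP (coord (vbasis {:L}%VS) j f)) => Q [P [Q0 E]].
apply: (spanned_div Q0).
rewrite ioE -scalerAl mul1r scalerA [_.[t] * _]mulrC E scaler_suml.
elim/big_ind: _ => [|g h|i _]; [exact: spanned0 | exact: spannedD |].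
rewrite -scalerA.
have -> v : (map_poly iota (P i)).[t] *: v = (map_poly io (P i)).[t%:A] * v.
  by rewrite ioE mulr_algl.
apply: spanned_poly; apply: spanned_mem; rewrite -[_ *: _]mulr_algl.
by apply: allpairs_f; [exact: mem_nth | rewrite mem_nth // size_tuple].
Qed.

Definition cover_curve (X : curve) (L : fieldExtType X) : curve :=
  Curve (cover_function_field L).

Definition cover_mor (X : curve) (L : fieldExtType X) :
  curve_mor (cover_curve L) X :=
  @CurveMor (cover_curve L) X (in_alg L) (fun=> erefl).

End Curves.

(** ** Berkovich analytification *)

Section Analytification.
Context {R : realType} {k : closedFieldType}.
Variable abs : k -> R.

Definition is_anpoint (X : curve k) (O : set X) (N : X -> R) : Prop :=
  [/\ [/\ forall c, O (cst X c),
          forall f g, O f -> O g -> O (f - g),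
          forall f g, O f -> O g -> O (f * g) &
          forall f, O f \/ O f^-1],
      forall f, ~ O f -> N f = 0,
      (forall f, O f -> 0 <= N f) /\ (forall c, N (cst X c) = abs c),
      forall f g, O f -> O g ->
        N (f * g) = N f * N g /\ N (f + g) <= Num.max (N f) (N g) &
      forall f, O f -> (N f = 0 <-> f = 0 \/ ~ O f^-1)].

(** A point of [X^an] is a scheme point [x] of [X] with an absolute value on
    its residue field extending [abs], i.e. a multiplicative seminorm
    [f |-> |f(p)|] on [O_{X,x}] whose kernel is the maximal ideal.  The value
    0 of [seminorm] outside [locring] is a convention without meaning. *)
Record anpoint (X : curve k) := AnPoint {
  locring : set X;
  seminorm : X -> R;
  anpointP : is_anpoint locring seminorm
}.

HB.instance Definition _ (X : curve k) := gen_eqMixin (anpoint X).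
HB.instance Definition _ (X : curve k) := gen_choiceMixin (anpoint X).

(** [U^an] for the complement [U] of the finite set [S] of closed points. *)
Definition zariski_an (X : curve k) (S : set (set X)) : set (anpoint X) :=
  [set p | ~ S (locring p)].

(** The coarsest topology for which [X^an -> X] is continuous and, for every
    Zariski open subset [U] and every [f] in [O(U)], so is [|f|] on [U^an]. *)
Definition an_subbase (X : curve k) : set (set (anpoint X)) :=
  [set A | exists (S : set (set X)) (f : X) (V : set R),
     [/\ finite_set S, ~ S setT,
         forall p, zariski_an S p -> locring p f,
         open V &
         A = [set p | zariski_an S p /\ V (seminorm p f)]]].

HB.instance Definition _ (X : curve k) :=
  isSubBaseTopological.Build (anpoint X) (@an_subbase X) id.

(** The map [g^an : X'^an -> X^an]. *)
Lemma anmap_subproof (X' X : curve k) (g : curve_mor X' X) (p : anpoint X') :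
  is_anpoint [set f | locring p (g f)] (fun f => seminorm p (g f)).
Proof.
case: p => O N [[Oc OB OM OV] NF [N0 Nc] NM NK] /=; split.
- split=> [c|f f'|f f'|f] /=.
  + by rewrite pullback_cst.
  + by rewrite rmorphB; apply: OB.
  + by rewrite rmorphM; apply: OM.
  + by rewrite fmorphV.
- by move=> f; apply: NF.
- by split=> [f|c]; [apply: N0 | rewrite pullback_cst].
- by move=> f f' Of Of'; rewrite rmorphM rmorphD; apply: NM.
- move=> f Of; rewrite NK //= fmorphV.
  by split=> -[/eqP|]; [rewrite fmorph_eq0 => /eqP ->; left | right
                      | move=> /eqP ->; rewrite rmorph0; left | right].
Qed.

Definition anmap (X' X : curve k) (g : curve_mor X' X) (p : anpoint X') :
  anpoint X := AnPoint (anmap_subproof g p).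

(** The completed residue field [H(p)], which is unique up to unique isometric
    isomorphism; [crf_ev f] is [f(p)], meaningful for [f] in [locring p]. *)
Record completed_residue_field (X : curve k) (p : anpoint X) := CRF {
  crf :> fieldType;
  crf_abs : crf -> R;
  crf_ev : X -> crf;
  crf_absP : is_absolute_value crf_abs;
  crf_complete : complete_for crf_abs;
  crf_ev1 : crf_ev 1 = 1;
  crf_evB : forall f g, locring p f -> locring p g ->
    crf_ev (f - g) = crf_ev f - crf_ev g;
  crf_evM : forall f g, locring p f -> locring p g ->
    crf_ev (f * g) = crf_ev f * crf_ev g;
  crf_ev_abs : forall f, locring p f -> crf_abs (crf_ev f) = seminorm p f;
  crf_dense : forall (h : crf) (e : R), 0 < e ->
    exists2 f, locring p f & crf_abs (h - crf_ev f) < e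
}.

(** *** Types of points *)

(** The [k]-points: the residue field of [O_{X,x}] is [k]. *)
Definition type_I (X : curve k) (p : anpoint X) : Prop :=
  forall f, locring p f -> exists c, seminorm p (f - cst X c) = 0.

Section Types.
Variables (X : curve k) (p : anpoint X) (H : completed_residue_field p).

Definition crf_cst (c : k) : H := crf_ev H (cst X c).

(** The residue of [h] is transcendental over the residue field of [k]. *)
Definition residually_transcendental (h : H) : Prop :=
  crf_abs h <= 1 /\
  forall P : {poly k}, (forall i, abs P`_i <= 1) -> (exists i, abs P`_i = 1) ->
    crf_abs (map_poly crf_cst P).[h] = 1.

(** The residue of [g] is algebraic over the subfield generated by the residue
    of [h] and the residue field of [k], for [h] residually transcendental. *)
Definition residually_algebraic_over (h g : H) : Prop :=
  exists Q : {poly {poly k}},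
    [/\ forall i j, abs Q`_i`_j <= 1, exists i j, abs Q`_i`_j = 1 &
        crf_abs (map_poly (fun q : {poly k} => (map_poly crf_cst q).[h]) Q).[g]
          < 1].

Definition residue_trdeg1 : Prop :=
  exists2 h : H, residually_transcendental h &
    forall g : H, crf_abs g <= 1 -> residually_algebraic_over h g.

(** [|H(p)^*| / |k^*|] has rational rank 1. *)
Definition value_rank1 : Prop :=
  exists h : H,
    [/\ h != 0,
        forall (n : nat) (c : k), (0 < n)%N -> c != 0 ->
          crf_abs h ^+ n != abs c &
        forall g : H, g != 0 -> exists (m : nat) (n : int) (c : k),
          [/\ (0 < m)%N, c != 0 & crf_abs g ^+ m = crf_abs h ^ n * abs c]].

End Types.

Definition type_II (X : curve k) (p : anpoint X) : Prop :=
  exists H : completed_residue_field p, residue_trdeg1 H.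

Definition type_III (X : curve k) (p : anpoint X) : Prop :=
  exists H : completed_residue_field p, value_rank1 H.

Definition type_IV (X : curve k) (p : anpoint X) : Prop :=
  [/\ ~ type_I p, ~ type_II p & ~ type_III p].

(** *** Analytic isomorphisms between open subsets *)

(** Analytic functions on [W]: locally uniform limits of rational functions
    without poles, as sections of the family [H(q)]. *)
Definition analytic (X : curve k) (H : forall q : anpoint X,
    completed_residue_field q) (W : set (anpoint X)) (s : forall q, H q) : Prop :=
  forall q, W q -> exists N : set (anpoint X),
    [/\ open N, N q, N `<=` W &
        forall e : R, 0 < e -> exists f : X, forall z, N z ->
          locring z f /\ crf_abs (s z - crf_ev (H z) f) <= e].

(** [rho : U -> V] is a homeomorphism of open sets, and the isomorphisms
    [theta q : H(rho q) -> H(q)] identify the structure sheaves (the curves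
    being reduced, a section is determined by its values). *)
Definition analytic_iso (X Y : curve k) (rho : anpoint X -> anpoint Y)
    (U : set (anpoint X)) (V : set (anpoint Y)) : Prop :=
  [/\ open V, set_bij U V rho,
      forall W, W `<=` V -> (open W <-> open (U `&` rho @^-1` W)) &
  exists (HX : forall q, completed_residue_field q)
         (HY : forall q, completed_residue_field q)
         (theta : forall q, HY (rho q) -> HX q),
    (forall q, U q ->
       [/\ forall g h, theta q (g + h) = theta q g + theta q h,
           forall g h, theta q (g * h) = theta q g * theta q h,
           forall c, theta q (crf_cst _ c) = crf_cst _ c,
           forall h, crf_abs (theta q h) = crf_abs h &
           forall h, exists g, theta q g = h]) /\
    (forall W (s : forall y, HY y), open W -> W `<=` V ->
       (analytic W s <->
        analytic (U `&` rho @^-1` W) (fun q => theta q (s (rho q)))))].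

(** ** Discs, annuli and skeleta *)

Local Notation coord := (P1_poly 'X).

(** [p] is [eta_{a,r}]; a polynomial has the same supremum on the [k]-points of
    the closed disc as on the whole disc, [k] being algebraically closed. *)
Definition is_eta (a : k) (r : R) (p : anpoint (P1 k)) : Prop :=
  forall P : {poly k}, locring p (P1_poly P) /\
    seminorm p (P1_poly P) = sup [set abs P.[x] | x in [set x | abs (x - a) <= r]].

Definition unit_disc : set (anpoint (P1 k)) :=
  [set p : anpoint (P1 k) | locring p coord /\ seminorm p coord < 1].

Definition punctured_unit_disc : set (anpoint (P1 k)) :=
  unit_disc `\` [set p | is_eta 0 0 p].

Definition annulus (r1 r2 : R) : set (anpoint (P1 k)) :=
  [set p : anpoint (P1 k) | locring p coord /\ r1 < seminorm p coord < r2].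

Definition in_value_group (r : R) : Prop := exists2 c : k, c != 0 & abs c = r.

Definition standard_annular (A : set (anpoint (P1 k))) : Prop :=
  A = punctured_unit_disc \/
  exists r1 r2, [/\ in_value_group r1, in_value_group r2, r1 < r2 &
                    A = annulus r1 r2].

Definition isomorphic_to (X : curve k) (U : set (anpoint X))
    (A : set (anpoint (P1 k))) : Prop :=
  exists rho, analytic_iso rho U A.

Definition component (T : topologicalType) (A D : set T) : Prop :=
  exists2 x, A x & D = connected_component A x.

Definition weak_semistable (X : curve k) (W : set (anpoint X)) : Prop :=
  [/\ finite_set W,
      forall p, W p -> type_I p \/ type_II p,
      finite_set [set D | component (~` W) D /\ ~ isomorphic_to D unit_disc] &
      forall D, component (~` W) D -> ~ isomorphic_to D unit_disc ->
        exists2 A, standard_annular A & isomorphic_to D A].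

Definition skeleton (X : curve k) (W : set (anpoint X)) : set (anpoint X) :=
  W `|` [set p | exists D A rho,
    [/\ component (~` W) D, D p, standard_annular A, analytic_iso rho D A &
        exists2 s : R, 0 < s & is_eta 0 s (rho p)]].

(** ** Ramification *)

Definition uniformizer (X : curve k) (x : anpoint X) (u : X) : Prop :=
  [/\ u != 0, locring x u, seminorm x u = 0 &
      forall f, locring x f -> seminorm x f = 0 -> locring x (f / u)].

(** The ramification index of [O_{X,x} -> O_{X',x'}] is [e]. *)
Definition ram_index (X' X : curve k) (g : curve_mor X' X)
    (x : anpoint X) (x' : anpoint X') (e : nat) : Prop :=
  exists (u : X) (u' v : X'),
    [/\ uniformizer x u, uniformizer x' u', locring x' v /\ locring x' v^-1 &
        v != 0 /\ g u = v * u' ^+ e].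

Definition an_fiber (X' X : curve k) (g : curve_mor X' X) (p : anpoint X) :
  set (anpoint X') := [set q | anmap g q = p].

Definition ramified_over (X' X : curve k) (g : curve_mor X' X)
    (x : anpoint X) : Prop :=
  type_I x /\
  exists x' e, [/\ an_fiber g x x', ram_index g x x' e & (1 < e)%N].

(** ** The retractions *)

Definition deformation_retraction (X : topologicalType) (h : R -> X -> X)
    (S : set X) : Prop :=
  [/\ {within `[0, 1] `*` setT, continuous (fun z : R * X => h z.1 z.2)},
      forall x, h 0 x = x,
      forall x, S (h 1 x) &
      forall t x, t \in `[0, 1] -> S x -> h t x = x].

(** The data chosen to construct the retractions: [K] Galois over [k(P^1)]
    containing [k(X')], where [X'' -> X' -> X -> P^1] is the covering defined
    by [K]; [g], [h] denote the maps [X'' -> X'] and [X' -> X]. *)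
Definition P1_vertex_set (X X' : curve k) (K : fieldExtType (P1 k))
    (a : curve_mor X (P1 k)) (h : curve_mor X' X)
    (g : curve_mor (cover_curve K) X')
    (A : set (anpoint (P1 k))) : Prop :=
  let Sigma := skeleton A in
  let c : curve_mor (cover_curve K) (P1 k) := comp_mor (comp_mor a h) g in
  let preim_ok Z (m : curve_mor Z (P1 k)) :=
    weak_semistable (anmap m @^-1` A) /\
    skeleton (anmap m @^-1` A) = anmap m @^-1` Sigma in
  [/\ weak_semistable A,
      forall x, ramified_over c x -> A x,
      preim_ok X a,
      preim_ok X' (comp_mor a h) &
      preim_ok (cover_curve K) c].

(** The infimum [u(p)] of the radii of the closed subdiscs of the open unit
    disc that contain [p]. *)
Definition disc_radius (p : anpoint (P1 k)) : R :=
  inf [set s | 0 < s < 1 /\ exists a : k,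
         abs a < 1 /\ seminorm p (P1_poly ('X - a%:P)) <= s].

(** [lam] is the standard retraction of [P^1] onto [Sigma]. *)
Definition P1_retraction (Sigma : set (anpoint (P1 k)))
    (lam : R -> anpoint (P1 k) -> anpoint (P1 k)) : Prop :=
  deformation_retraction lam Sigma /\
      forall D, component (~` Sigma) D ->
        exists2 rho, analytic_iso rho D unit_disc &
        forall p, D p ->
          [/\ forall t, 0 <= t -> t <= disc_radius (rho p) -> lam t p = p,
              forall t x, disc_radius (rho p) < t -> t < 1 -> abs x < 1 ->
                seminorm (rho p) (P1_poly ('X - x%:P)) <= t ->
                D (lam t p) /\ is_eta x t (rho (lam t p)) &
              closure D `\` D = [set lam 1 p]].

(** [gamma : [0,1] -> Y^an] lifts the path [delta] and starts at [q]. *)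
Definition path_lift (Y X : curve k) (c : curve_mor Y X)
    (delta : R -> anpoint X) (q : anpoint Y) (gamma : R -> anpoint Y) : Prop :=
  [/\ {within `[0, 1], continuous gamma}, gamma 0 = q &
      forall t, t \in `[0, 1] -> anmap c (gamma t) = delta t].

(** [psi'' (., q)] is the unique lift of [lam (., c^an q)] starting at [q]. *)
Definition lifted_retraction (Y X : curve k) (c : curve_mor Y X)
    (Sigma : set (anpoint X)) (lam : R -> anpoint X -> anpoint X)
    (psi'' : R -> anpoint Y -> anpoint Y) : Prop :=
  deformation_retraction psi'' (anmap c @^-1` Sigma) /\
  forall q, let delta := fun t => lam t (anmap c q) in
    path_lift c delta q (fun t => psi'' t q) /\
    forall gamma, path_lift c delta q gamma ->
      forall t, t \in `[0, 1] -> gamma t = psi'' t q.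

Definition induced_retraction (Y X : curve k) (g : curve_mor Y X)
    (S : set (anpoint X)) (psi'' : R -> anpoint Y -> anpoint Y)
    (psi : R -> anpoint X -> anpoint X) : Prop :=
  deformation_retraction psi S /\
  forall t q, t \in `[0, 1] -> psi t (anmap g q) = anmap g (psi'' t q).

(** ** Invariants *)

(** 0 when the set is infinite. *)
Definition set_card (T : choiceType) (A : set T) : nat := #|` fset_set A|%fset.

(** [p] is in [psi(r, C(k))]. *)
Definition reached (X : curve k) (psi : R -> anpoint X -> anpoint X)
    (p : anpoint X) (r : R) : Prop :=
  exists2 x, type_I x & psi r x = p.

(** [r = r_p]. *)
Definition is_radius (X : curve k) (psi : R -> anpoint X -> anpoint X)
    (p : anpoint X) (r : R) : Prop :=
  [/\ r \in `[0, 1], reached psi p r &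
      forall s, s \in `[0, 1] -> reached psi p s -> r <= s].

Section Invariants.
Variables (X' X : curve k) (g : curve_mor X' X).

Definition n_ (p : anpoint X) : nat := set_card (an_fiber g p).

(** [ram] and [c_] are computed from an arbitrarily chosen point over [x]. *)
Definition ram (x : anpoint X) : nat :=
  xget 0%N [set e | exists2 x', an_fiber g x x' & ram_index g x x' e].

Definition c_ (psi' : R -> anpoint X' -> anpoint X') (r : R) (x : anpoint X) :
    nat :=
  xget 0%N [set n | exists2 x', an_fiber g x x' &
    n = set_card [set y' | [/\ type_I y', an_fiber g x y' &
                               psi' r y' = psi' r x']]].

End Invariants.

End Analytification.

(* Main.v *)
Require Import Defs.
From HB Require Import structures.
From mathcomp Require Import all_boot all_order all_algebra all_fingroup all_field.
From mathcomp Require Import all_classical all_reals all_analysis.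
From mathcomp Require Import finmap ring zify.
Set Implicit Arguments.
Unset Strict Implicit.
Unset Printing Implicit Defensive.
Import Order.TTheory GRing.Theory Num.Theory.
Local Open Scope classical_set_scope.
Local Open Scope ring_scope.

(** The Galois group [G] of [k(C')/k(C)] acts transitively on the fibres of
    [phi^an], so [n_p] is the index of the stabilizer [D_q] of a point [q] over
    [p].  For [y] over [x] in [C(k)] the residue field is algebraically closed
    and [D_y] has order [ram(x)].  An element of [G] extends to an automorphism
    of [K] over [k(P^1)], which permutes the unique lifts of paths; hence
    [psi'] is [G]-equivariant.  For [q = psi'(r, y)], the points [y'] over [x]
    with [psi'(r, y') = q] thus form the orbit [D_q y], so that
    [c_r(x) ram(x) = #|D_q|] and [n_p c_r(x) ram(x) = #|G|]. *)

(** A point is a local ring together with a seminorm, and handling the two separately would split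
    the argument by types of points. Both are encoded in one valuation ring, [unitball]; as [|k^*|]
    is dense, this ring determines the point. Transitivity on fibres then becomes the classical
    conjugacy of valuation rings in a Galois extension. Elements with prescribed behaviour at all
    conjugates come from [avoidance] instead of an approximation theorem: the residue field of [k]
    is infinite, so a generic combination escapes finitely many conditions. The same argument
    extends automorphisms to [K]. Ramification may be wild, so the order of [D_y] is found by two
    inequalities: the norm of a suitable uniformizer shows that [ram(x)] divides it, and linear
    independence of automorphisms bounds it above by [ram(x)]. Since [ram] and [c_] are 0 when there
    is nothing to choose from, points above [x] must be constructed; this is Chevalley's extension
    theorem for valuation rings. *)

(* MathComp-Analysis's constant functions shadow the embedding of [k]. *)
Local Notation cst := Defs.cst.

(** * Absolute values on an algebraically closed field *)

Section AbsoluteValue.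
Context {R : realType} {k : closedFieldType} {abs : k -> R}.
Hypothesis habs : is_absolute_value abs.

Lemma abs_ge0 c : 0 <= abs c.
Proof. by case: habs => + _ _ _; apply. Qed.

Lemma abs_eq0 c : (abs c == 0) = (c == 0).
Proof. by case: habs => _ h _ _; apply/eqP/eqP => /h. Qed.

Lemma absM : {morph abs : c d / c * d}.
Proof. by case: habs => _ _ + _; apply. Qed.

Lemma abs0 : abs 0 = 0.
Proof. by apply/eqP; rewrite abs_eq0. Qed.

Lemma abs1 : abs 1 = 1.
Proof.
have h : abs 1 != 0 by rewrite abs_eq0 oner_neq0.
by apply: (mulfI h); rewrite -absM !mulr1.
Qed.

Lemma absN c : abs (- c) = abs c.
Proof.
have /eqP : abs (-1) ^+ 2 = 1 by rewrite expr2 -absM mulrNN mulr1 abs1.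
rewrite sqrf_eq1 => /orP[/eqP h|/eqP h]; first by rewrite -mulN1r absM h mul1r.
by have := abs_ge0 (-1); rewrite h ler0N1.
Qed.

Lemma absB_le c d B : abs c <= B -> abs d <= B -> abs (c - d) <= B.
Proof.
case: habs => _ _ _ h cB dB; apply: le_trans (h _ _) _.
by rewrite ge_max cB absN.
Qed.

Lemma absX c n : abs (c ^+ n) = abs c ^+ n.
Proof. by elim: n => [|n IH]; rewrite ?abs1 // !exprS absM IH. Qed.

Lemma absV c : abs c^-1 = (abs c)^-1.
Proof.
have [->|c0] := eqVneq c 0; first by rewrite invr0 abs0 invr0.
have ac : abs c != 0 by rewrite abs_eq0.
by apply: (mulfI ac); rewrite -absM !divff // abs1.
Qed.

Lemma abs_prod (I : Type) (r : seq I) (F : I -> k) :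
  abs (\prod_(i <- r) F i) = \prod_(i <- r) abs (F i).
Proof. by apply: (big_morph abs absM abs1). Qed.

(* A root of [prod (X - d) + 1] has distance 1 to each [d]: the residue field
   of [k], being algebraically closed, is infinite. *)
Lemma fresh_residue (s : seq k) : (forall d, d \in s -> abs d <= 1) ->
  exists2 c, abs c <= 1 & forall d, d \in s -> abs (c - d) = 1.
Proof.
move=> hs; case: s hs => [|d0 s0] hs; first by exists 0; rewrite ?abs0 ?ler01.
set s := d0 :: s0 in hs *.
pose P : {poly k} := \prod_(d <- s) ('X - d%:P) + 1%:P.
have szP : size P != 1.
  rewrite /P -(big_map id xpredT (fun d => 'X - d%:P)) map_id.
  by rewrite size_polyDl size_prod_XsubC // size_polyC oner_eq0.
have /closed_rootP [c] := szP; rewrite rootE /P !hornerE horner_prod.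
under eq_bigr do rewrite !hornerE.
move=> /eqP /addr0_eq /(congr1 abs); rewrite absN abs1 abs_prod => E.
have c1 : abs c <= 1.
  rewrite leNgt; apply/negP => c1.
  have : 1 < \prod_(d <- s) abs (c - d); last first.
    by rewrite E ltxx.
  have big d : d \in s -> 1 < abs (c - d).
    move=> ds; rewrite ltNge; apply/negP => h.
    have := absB_le h (_ : abs (- d) <= 1); rewrite absN opprK subrK.
    by move=> /(_ (hs _ ds)); rewrite leNgt c1.
  rewrite /s big_cons; apply: (lt_le_trans (big _ (mem_head _ _))).
  rewrite ler_peMr ?abs_ge0 // big_seq.
  elim/big_ind: _ => [|x y x1 y1|d ds]; rewrite ?lexx //.
    by rewrite -[1]mulr1 ler_pM ?ler01.
  by apply/ltW/big; rewrite inE ds orbT.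
have cd1 d : d \in s -> abs (c - d) <= 1 by move=> /hs; apply: absB_le.
(* All factors are at most 1 and their product is 1, so none is smaller. *)
exists c => // d ds; apply/eqP; rewrite eq_le cd1 //= -E.
rewrite (perm_big _ (perm_to_rem ds)) big_cons ler_piMr ?abs_ge0 // big_seq.
by apply: prodr_ile1 => e /mem_rem es; rewrite abs_ge0 cd1.
Qed.

Hypothesis habs1 : exists c, c != 0 /\ abs c != 1.

Lemma bernoulli (e : R) n : 0 <= e -> e * n%:R < (1 + e) ^+ n.
Proof.
move=> e0; elim: n => [|m IH]; first by rewrite mulr0 expr0 ltr01.
have p1 : 1 <= (1 + e) ^+ m by apply: exprn_ege1; rewrite lerDl.
by rewrite exprS mulrDl mul1r -natr1 mulrDr mulr1 ltr_leD // ler_peMr.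
Qed.

Lemma expr_unbounded (x B : R) : 1 < x -> exists n, B < x ^+ n.
Proof.
rewrite -subr_gt0 => e0; exists (Num.bound `|B / (x - 1)|).
have := bernoulli (Num.bound `|B / (x - 1)|) (ltW e0); rewrite [1 + _]addrC subrK.
apply: lt_trans; rewrite mulrC -ltr_pdivrMr //.
exact: le_lt_trans (ler_norm _) (archi_boundP (normr_ge0 _)).
Qed.

Lemma abs_unbounded (B : R) : exists c, B < abs c.
Proof.
have [c c1] : exists c, 1 < abs c.
  have [c [c0 /negPf ac]] := habs1.
  have [h|h] := ltP 1 (abs c); first by exists c.
  exists c^-1; rewrite absV invf_gt1 ?lt_neqAle ?ac //.
  by rewrite eq_sym abs_eq0 c0 abs_ge0.
have [n Bn] := expr_unbounded B c1.
by exists (c ^+ n); rewrite absX.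
Qed.

(** Since [k] is algebraically closed, high roots of a large element have absolute value just above
    1; the powers of such a root grow by steps too short to jump over the interval. *)
Lemma abs_dense (x y : R) : 0 <= x -> x < y -> exists c, x < abs c < y.
Proof.
move=> x0 xy.
wlog {x0} x0 : x xy / 0 < x.
  move=> h; have y0 : 0 < y by apply: le_lt_trans xy.
  have m0 : 0 < Num.max x (y / 2) by rewrite lt_max divr_gt0 ?orbT.
  have [|c /andP[h1 h2]] := h _ _ m0.
    by rewrite gt_max xy ltr_pdivrMr // ltr_pMr // ltr1n.
  by exists c; rewrite h2 andbT; apply: le_lt_trans h1; rewrite le_max lexx.
(* With [y > 1], the least power of [d] that reaches [y] has positive exponent, and its predecessor
   is the witness. *)
wlog y1 : x y x0 xy / 1 < y.
  move=> h; have y0 : 0 < y by apply: lt_trans xy.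
  have [d dy] := abs_unbounded y^-1.
  have d0 : 0 < abs d by apply: lt_trans dy; rewrite invr_gt0.
  have [|||c /andP[h1 h2]] := h (x * abs d) (y * abs d).
  - exact: mulr_gt0.
  - by rewrite ltr_pM2r.
  - by rewrite -ltr_pdivrMl // mulr1.
  by exists (c / d); rewrite absM absV ltr_pdivlMr // ltr_pdivrMr // h1 h2.
have [d d1 dxy] : exists2 d, 1 < abs d & abs d * x < y.
  have [C C1] := abs_unbounded 1.
  have [n Cn] : exists n, abs C < (y / x) ^+ n.
    by apply: expr_unbounded; rewrite ltr_pdivlMr ?mul1r.
  have n0 : (0 < n)%N.
    rewrite lt0n; apply: contraTneq Cn => ->.
    by rewrite expr0 -leNgt ltW.
  have sz : size ('X^n - C%:P : {poly k}) != 1.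
    by rewrite size_XnsubC // eqSS -lt0n.
  have /closed_rootP [d] := sz; rewrite rootE !hornerE subr_eq0 => /eqP dn.
  exists d.
    rewrite ltNge; apply/negP => d1.
    by move: C1; rewrite -dn absX ltNge exprn_ile1 // abs_ge0.
  rewrite -ltr_pdivlMr // ltNge; apply/negP => d1.
  move: Cn; rewrite -dn absX ltNge => /negP; apply.
  by rewrite lerXn2r // nnegrE ?abs_ge0 // divr_ge0 // ltW // (lt_trans x0).
have ex : exists n, y <= abs d ^+ n.
  by have [n /ltW] := expr_unbounded y d1; exists n.
case: (ex_minnP ex) => -[|n] yn minn; first by move: yn; rewrite expr0 leNgt y1.
exists (d ^+ n); rewrite absX; apply/andP; split; last first.
  by rewrite ltNge; apply/negP => /minn; rewrite ltnn.
rewrite -(ltr_pM2l (lt_trans ltr01 d1)) -exprS.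
exact: lt_le_trans yn.
Qed.

End AbsoluteValue.

(** * Linear dependence over [k(t)] *)

Lemma fracE (D : idomainType) (x : {fraction D}) :
  exists nd : D * D, nd.2 != 0 /\
    x * FracField.tofrac nd.2 = FracField.tofrac nd.1.
Proof.
elim/quotW: x => x; exists (frac x); split; first exact: denom_ratioP.
unlock FracField.tofrac; rewrite -[LHS]FracField.pi_mul.
apply/eqmodP; rewrite /= FracField.equivfE /FracField.mulf.
by rewrite !numden_Ratio ?oner_neq0 ?mulr1 ?denom_ratioP // mulrC.
Qed.

(** A kernel vector over the fraction field is multiplied by a common denominator. *)
Lemma exists_left_kernel (D : idomainType) m n (A : 'M[D]_(m, n)) :
  (n < m)%N -> exists2 v : 'rV[D]_m, v != 0 & v *m A = 0.
Proof.
move=> nm; pose B := map_mx (FracField.tofrac (R:=D)) A.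
have : kermx B != 0.
  by rewrite -mxrank_eq0 mxrank_ker -lt0n subn_gt0 (leq_ltn_trans (rank_leq_col _)).
case/rowV0Pn => w /sub_kermxP wB w0.
have [nd ndE] := choice (fun j => fracE (w 0 j)).
pose d := \prod_j (nd j).2.
have d0 : d != 0 by apply/prodf_neq0 => j _; case: (ndE j).
pose v := \row_j ((nd j).1 * \prod_(l | l != j) (nd l).2).
have vE : map_mx (FracField.tofrac (R:=D)) v = FracField.tofrac d *: w.
  apply/rowP => j; rewrite !mxE rmorphM /= -(ndE j).2 -mulrA -rmorphM.
  by rewrite mulrC /d [in RHS](bigD1 j).
exists v.
  apply: contraNneq w0 => v0; move: vE; rewrite v0 map_mx0 => /esym/eqP.
  by rewrite scaler_eq0 tofrac_eq0 (negPf d0).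
apply/rowP => j; apply/eqP; rewrite [X in _ == X]mxE -tofrac_eq0.
have -> : FracField.tofrac ((v *m A) 0 j)
    = map_mx (FracField.tofrac (R:=D)) (v *m A) 0 j by rewrite [RHS]mxE.
by rewrite map_mxM vE -scalemxAl wB scaler0 mxE.
Qed.

Section FunctionField.
Variables (k : closedFieldType) (F : fieldType) (iota : {rmorphism k -> F}).
Local Notation "P .{ t }" := (map_poly iota P).[t] (at level 2, format "P .{ t }").

(* [F] has dimension less than [n] over [k(t)]. *)
Definition dependent_over t n := forall x : 'I_n -> F,
  exists2 phi : 'I_n -> {poly k}, exists i, phi i != 0 &
    \sum_i (phi i).{t} * x i = 0.

(** The coefficient matrix has one row more than columns, hence a left kernel; its entries are
    weighted by the denominators [Q i]. *)
Lemma spanned_dependent t s :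
  (forall f, spanned iota t s f) -> dependent_over t (size s).+1.
Proof.
move=> sP x; have [Q QP] := choice (fun i => sP (x i)).
have [P PP] := choice QP.
have [v v0 vA] := exists_left_kernel (\matrix_(i, j) P i j) (ltnSn _).
exists (fun i => Q i * v 0 i).
  have [j vj] : exists j, v 0 j != 0.
    apply/existsP; rewrite -negb_forall; apply: contraNN v0 => /forallP h.
    by apply/eqP/rowP => j; rewrite mxE; apply/eqP.
  by exists j; rewrite mulf_neq0 //; case: (PP j).
under eq_bigr => i _.
  rewrite rmorphM hornerM mulrC mulrA (PP i).2 mulr_suml.
  under eq_bigr do rewrite mulrAC.
  over.
rewrite exchange_big big1 // => j _ /=; rewrite -mulr_suml.
suff -> : \sum_i (P i j).{t} * (v 0 i).{t} = 0 by rewrite mul0r.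
have := congr1 (fun M : 'rV_(size s) => (M 0 j).{t}) vA.
rewrite !mxE rmorph0 horner0 rmorph_sum horner_sum => vAj; rewrite -[RHS]vAj.
by apply: eq_bigr => i _; rewrite !mxE rmorphM hornerM mulrC.
Qed.

Lemma dependent_shift t n c :
  dependent_over t n -> dependent_over (t - iota c) n.
Proof.
move=> dep x; have [phi [i phi0] E] := dep x.
exists (fun i => phi i \Po ('X + c%:P)).
  by exists i; rewrite comp_poly2_eq0 // size_XaddC.
rewrite -[RHS]E; apply: eq_bigr => j _; congr (_ * _).
rewrite map_comp_poly rmorphD /= map_polyX map_polyC horner_comp !hornerE.
by rewrite subrK.
Qed.

Lemma dependent_inv t n : t != 0 ->
  dependent_over t n -> dependent_over t^-1 n.
Proof.
move=> t0 dep x; have [phi [i phi0] E] := dep x.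
(* Reversal with respect to a common length divides every coefficient by the same power of [t]. *)
pose N := \max_i size (phi i).
have le_N j : (size (phi j) <= N)%N by apply: leq_bigmax.
pose rev j := \poly_(l < N) (phi j)`_(N.-1 - l).
exists rev; last first.
  suff revE j : (rev j).{t^-1} = t ^- N.-1 * (phi j).{t}.
    by under eq_bigr do rewrite revE -mulrA; rewrite -mulr_sumr E mulr0.
  rewrite (@horner_coef_wide _ N (map_poly iota (rev j))); last first.
    by rewrite size_map_poly size_poly.
  rewrite (@horner_coef_wide _ N); last by rewrite size_map_poly.
  rewrite mulr_sumr (reindex_inj rev_ord_inj) /=; apply: eq_bigr => l _.
  have lN := ltn_ord l.
  rewrite !coef_map coef_poly ltn_subrL /=.
  have -> : (0 < N)%N by apply: leq_ltn_trans lN.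
  have -> : (N.-1 - (N - l.+1))%N = l by rewrite -subn1 subnBA // addnC; lia.
  rewrite mulrCA; congr (_ * _).
  have -> : N.-1 = (l + (N - l.+1))%N by lia.
  rewrite exprD invfM mulrAC.
  by rewrite mulVf ?expf_neq0 // mul1r exprVn.
have [l phil] : exists l, (phi i)`_l != 0.
  by exists (size (phi i)).-1; rewrite -lead_coefE lead_coef_eq0.
have lN : (l < N)%N.
  by rewrite ltnNge; apply: contra phil => h; rewrite nth_default // (leq_trans (le_N i)).
exists i; apply/eqP => /(congr1 (fun p : {poly k} => p`_(N.-1 - l))).
have -> : rev i = \poly_(j < N) (phi i)`_(N.-1 - j) by [].
rewrite coef_poly coef0 ifT; last by lia.
have lN1 : (l <= N.-1)%N by lia.
by rewrite subKn //; apply/eqP.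
Qed.
End FunctionField.

(** * Points and their valuation rings *)

Lemma mulr_ile_lt1 (R : numDomainType) (x y : R) :
  0 <= x -> 0 <= y -> x <= 1 -> y < 1 -> x * y < 1.
Proof.
move=> x0 y0 x1; apply: le_lt_trans.
by rewrite ler_piMl.
Qed.

Section Points.
Context {R : realType} {k : closedFieldType} {abs : k -> R}.
Hypothesis habs : nontrivial_complete abs.
Let hav : is_absolute_value abs. Proof. by case: habs. Qed.
Let habs1 : exists c, c != 0 /\ abs c != 1. Proof. by case: habs. Qed.

Section OnePoint.
Variables (X : curve k) (q : anpoint abs X).
Local Notation O := (locring q).
Local Notation N := (seminorm q).

Lemma locring_cst c : O (cst X c).
Proof. by case: (anpointP q) => -[]. Qed.

Lemma locringB f g : O f -> O g -> O (f - g).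
Proof. by case: (anpointP q) => -[_ h _ _ _ _ _ _]; apply: h. Qed.

Lemma locringM f g : O f -> O g -> O (f * g).
Proof. by case: (anpointP q) => -[_ _ h _ _ _ _ _]; apply: h. Qed.

Lemma locringV f : O f \/ O f^-1.
Proof. by case: (anpointP q) => -[_ _ _ h _ _ _ _]; apply: h. Qed.

Lemma locring1 : O 1.
Proof. by have := locring_cst 1; rewrite rmorph1. Qed.

Lemma locring0 : O 0.
Proof. by have := locring_cst 0; rewrite rmorph0. Qed.

Lemma locringN f : O f -> O (- f).
Proof. by rewrite -sub0r; apply/locringB/locring0. Qed.

Lemma locringD f g : O f -> O g -> O (f + g).
Proof. by move=> Of /locringN; rewrite -{2}[g]opprK; apply: locringB. Qed.

Lemma locringX f n : O f -> O (f ^+ n).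
Proof.
by move=> Of; elim: n => [|n IH]; [exact: locring1 | rewrite exprS; apply: locringM].
Qed.

Lemma locring_sum (I : Type) (r : seq I) (P : pred I) (F : I -> X) :
  (forall i, P i -> O (F i)) -> O (\sum_(i <- r | P i) F i).
Proof. exact: (big_ind O locring0 locringD). Qed.

Lemma seminorm_out f : ~ O f -> N f = 0.
Proof. by case: (anpointP q) => _ h _ _ _; apply: h. Qed.

Lemma seminorm_ge0 f : 0 <= N f.
Proof.
case: (pselect (O f)) => [|/seminorm_out -> //].
by case: (anpointP q) => _ _ [h _] _ _; apply: h.
Qed.

Lemma seminorm_cst c : N (cst X c) = abs c.
Proof. by case: (anpointP q) => _ _ [_ h] _ _; apply: h. Qed.

Lemma seminormM f g : O f -> O g -> N (f * g) = N f * N g.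
Proof. by move=> Of Og; case: (anpointP q) => _ _ _ h _; case: (h f g). Qed.

Lemma seminormD f g : O f -> O g -> N (f + g) <= Num.max (N f) (N g).
Proof. by move=> Of Og; case: (anpointP q) => _ _ _ h _; case: (h f g). Qed.

Lemma seminorm_eq0 f : O f -> N f = 0 -> f = 0 \/ ~ O f^-1.
Proof. by move=> Of; case: (anpointP q) => _ _ _ _ h; case: (h f Of). Qed.

Lemma seminorm_nonunit f : O f -> ~ O f^-1 -> N f = 0.
Proof. by move=> Of ?; case: (anpointP q) => _ _ _ _ h; apply/h => //; right. Qed.

Lemma seminorm0 : N 0 = 0.
Proof. by have := seminorm_cst 0; rewrite rmorph0 abs0. Qed.

Lemma seminorm1 : N 1 = 1.
Proof. by have := seminorm_cst 1; rewrite rmorph1 abs1. Qed.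

Lemma seminormN f : O f -> N (- f) = N f.
Proof.
move=> Of; rewrite -mulN1r -(rmorph1 (cst X)) -rmorphN seminormM //.
  by rewrite seminorm_cst absN // abs1 // mul1r.
exact: locring_cst.
Qed.

Lemma seminormB_le f g B : O f -> O g -> N f <= B -> N g <= B -> N (f - g) <= B.
Proof.
move=> Of Og fB gB; apply: le_trans (seminormD Of (locringN Og)) _.
by rewrite ge_max fB seminormN.
Qed.

Lemma seminormB_lt f g B : O f -> O g -> N f < B -> N g < B -> N (f - g) < B.
Proof.
move=> Of Og fB gB; apply: le_lt_trans (seminormD Of (locringN Og)) _.
by rewrite gt_max fB seminormN.
Qed.

Lemma seminorm_inv f : O f -> N f != 0 -> O f^-1 /\ N f^-1 = (N f)^-1.
Proof.
move=> Of Nf; have OV : O f^-1.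
  by apply: contrapT => /(seminorm_nonunit Of)/eqP; apply/negP.
split=> //; apply: (mulfI Nf); rewrite -seminormM // !divff ?seminorm1 //.
by apply: contraNneq Nf => ->; rewrite seminorm0.
Qed.

Lemma seminorm_neq0 f : f != 0 -> O f -> O f^-1 -> N f != 0.
Proof.
move=> f0 Of OV; apply/eqP => /(seminorm_eq0 Of)[/eqP|//]; exact/negP.
Qed.

Lemma seminorm_prod (I : Type) (r : seq I) (P : pred I) (F : I -> X) :
  (forall i, P i -> O (F i)) ->
  O (\prod_(i <- r | P i) F i) /\
  N (\prod_(i <- r | P i) F i) = \prod_(i <- r | P i) N (F i).
Proof.
move=> h; elim/big_rec2: _ => [|i y z Pi [Oz <-]].
  by split; [exact: locring1 | exact: seminorm1].
by split; [apply: locringM => //; apply: h | rewrite seminormM //; apply: h].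
Qed.

(* The valuation ring of the composite of [locring q] with the valuation
   [seminorm q] of its residue field, and its maximal ideal. *)
Definition unitball f := O f /\ N f <= 1.
Definition openball f := O f /\ N f < 1.

Lemma open_unitball f : openball f -> unitball f.
Proof. by move=> [Of /ltW]. Qed.

Lemma unitball_cst c : abs c <= 1 -> unitball (cst X c).
Proof. by split; [exact: locring_cst | rewrite seminorm_cst]. Qed.

Lemma unitballB f g : unitball f -> unitball g -> unitball (f - g).
Proof.
by move=> [Of f1] [Og g1]; split; [exact: locringB | exact: seminormB_le].
Qed.

Lemma unitballM f g : unitball f -> unitball g -> unitball (f * g).
Proof.
move=> [Of f1] [Og g1]; split; first exact: locringM.
by rewrite seminormM // mulr_ile1 ?seminorm_ge0.
Qed.

Lemma unitballD f g : unitball f -> unitball g -> unitball (f + g).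
Proof.
move=> Vf [Og g1]; rewrite -[g]opprK; apply: unitballB => //.
by split; [exact: locringN | rewrite seminormN].
Qed.

Lemma openballB f g : openball f -> openball g -> openball (f - g).
Proof.
by move=> [Of f1] [Og g1]; split; [exact: locringB | exact: seminormB_lt].
Qed.

Lemma openballM f g : unitball f -> openball g -> openball (f * g).
Proof.
move=> [Of f1] [Og g1]; split; first exact: locringM.
by rewrite seminormM // mulr_ile_lt1 ?seminorm_ge0.
Qed.

Lemma unitballV f : unitball f \/ openball f^-1.
Proof.
have [Of|nOf] := pselect (O f); last first.
  right; have [//|OV] := locringV f; split=> //.
  by rewrite seminorm_nonunit ?ltr01 // invrK.
have [f1|f1] := leP (N f) 1; first by left.
have [//|OV NV] := seminorm_inv Of _; first by rewrite gt_eqF // (lt_trans ltr01).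
by right; split=> //; rewrite NV invf_lt1 // (lt_trans ltr01).
Qed.

End OnePoint.

(* If [a] avoids all but one of the subgroups and [b] avoids the last one, then
   each subgroup contains [a + c b] for at most one residue class of [c]. *)
Lemma avoidance (L : fieldType) (iota : {rmorphism k -> L}) (I : finType)
    (P : set L) (M : I -> set L) :
    P 0 ->
    (forall f g c, abs c <= 1 -> P f -> P g -> P (f + iota c * g)) ->
    (forall i f g, M i f -> M i g -> M i (f - g)) ->
    (forall i c f, abs c <= 1 -> M i f -> M i (iota c * f)) ->
    (forall i, exists2 f, P f & ~ M i f) ->
  exists2 f, P f & forall i, ~ M i f.
Proof.
move=> P0 PD MB MZ PM.
suff h (r : seq I) : exists2 f, P f & forall i, i \in r -> ~ M i f.
  by have [f Pf fM] := h (enum I); exists f => // i; apply: fM; rewrite mem_enum.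
elim: r => [|i r [a Pa aM]]; first by exists 0.
have [b Pb bM] := PM i.
(* [bc j] represents the only residue class that can be bad at [j] (0 if there is none); [c] is then
   taken outside all these classes. *)
pose bad j := [set c | abs c <= 1 /\ M j (a + iota c * b)].
pose bc j := xget 0 (bad j).
have bc1 j : abs (bc j) <= 1.
  by rewrite /bc; case: xgetP => [c _ []|_] //; rewrite abs0 // ler01.
have [d|c c1 hc] := @fresh_residue _ _ _ hav [seq bc j | j <- i :: r].
  by case/mapP => j _ ->.
exists (a + iota c * b) => [|j jr Mj]; first exact: PD.
have [_ Mj'] : bad j (bc j) by apply: (@xgetI _ _ _ c).
have cj : abs (c - bc j) = 1 by apply: hc; apply: map_f.
have c0 : c - bc j != 0 by rewrite -(abs_eq0 hav) cj oner_neq0.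
have Mb : M j b.
  have := MB _ _ _ Mj Mj'; rewrite opprD addrACA subrr add0r -mulrBl -rmorphB.
  move=> /(MZ j (c - bc j)^-1); rewrite mulrA -rmorphM mulVf // rmorph1 mul1r.
  by apply; rewrite absV // cj invr1.
have Ma : M j a.
  by have := MB _ _ _ Mj (MZ _ _ _ c1 Mb); rewrite addrK.
by move: jr; rewrite inE => /orP[/eqP E|/aM //]; apply: bM; rewrite -E.
Qed.

Section Extensionality.
Variable X : curve k.

Lemma anpoint_eq (q1 q2 : anpoint abs X) :
  locring q1 = locring q2 -> seminorm q1 = seminorm q2 -> q1 = q2.
Proof.
case: q1 q2 => [loc1 nm1 h1] [loc2 nm2 h2] /= EO EN.
by subst; congr AnPoint; apply: Prop_irrelevance.
Qed.

(** The ball recovers both parts of the point: a constant of large absolute value scales any element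
    of [locring] into it, and a strict inequality of seminorms is detected by a constant whose
    absolute value lies in between. *)
Lemma sub_unitball (q1 q2 : anpoint abs X) :
    unitball q1 `<=` unitball q2 -> unitball q2 `<=` unitball q1 ->
  locring q1 `<=` locring q2 /\
  forall f, locring q1 f -> locring q2 f -> seminorm q1 f <= seminorm q2 f.
Proof.
have scale (q : anpoint abs X) f c : c != 0 ->
    unitball q (f * cst X c) <-> locring q f /\ seminorm q f * abs c <= 1.
  move=> c0; rewrite /unitball -(seminorm_cst q).
  have Oc := locring_cst q c.
  split=> -[Of]; last by rewrite seminormM //; split => //; apply: locringM.
  have {}Of : locring q f.
    have := locringM Of (locring_cst q c^-1).
    by rewrite -mulrA -rmorphM divff // rmorph1 mulr1.
  by rewrite seminormM.
move=> V12 V21; have loc12 : locring q1 `<=` locring q2.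
  move=> f Of; have [c cf] := abs_unbounded hav habs1 (seminorm q1 f).
  have c0 : c != 0.
    rewrite -(abs_eq0 hav) gt_eqF //; exact: le_lt_trans (seminorm_ge0 _ _) cf.
  have cV : c^-1 != 0 by rewrite invr_eq0.
  suff /V12/(scale _ _ _ cV)[] : unitball q1 (f * cst X c^-1) by [].
  apply/(scale _ _ _ cV); split=> //.
  by rewrite absV // ler_pdivrMr ?mul1r ?ltW // lt_def abs_eq0 // c0 abs_ge0.
split=> // f O1 O2; rewrite leNgt; apply/negP => lt21.
have [c /andP[c2 c1]] := abs_dense hav habs1 (seminorm_ge0 q2 f) lt21.
have c0 : c != 0.
  rewrite -(abs_eq0 hav) gt_eqF //; exact: le_lt_trans (seminorm_ge0 _ _) c2.
have pc : 0 < abs c by rewrite lt_def abs_eq0 // c0 abs_ge0.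
have cV : c^-1 != 0 by rewrite invr_eq0.
have /V21/(scale _ _ _ cV)[_] : unitball q2 (f * cst X c^-1).
  apply/(scale _ _ _ cV); split=> //.
  by rewrite absV // ler_pdivrMr ?mul1r ?ltW.
by rewrite absV // ler_pdivrMr ?mul1r // leNgt c1.
Qed.

Lemma unitball_inj (q1 q2 : anpoint abs X) :
  unitball q1 `<=` unitball q2 -> unitball q2 `<=` unitball q1 -> q1 = q2.
Proof.
move=> V12 V21; have [loc12 N12] := sub_unitball V12 V21.
have [loc21 N21] := sub_unitball V21 V12.
apply: anpoint_eq; first by apply/seteqP.
apply/funext => f; have [Of|nO] := pselect (locring q1 f).
  have O2 := loc12 _ Of; by apply/eqP; rewrite eq_le N12 // N21.
by rewrite !seminorm_out // => /loc21.
Qed.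

(* [(f - c)^-1] and [f (f - c)^-1] are integral at all the given points when
   the residue of [c] differs from those of [f]. *)
Lemma inv_shift (I : finType) (q : I -> anpoint abs X) (f : X) :
  exists2 c, abs c <= 1 & forall i, unitball (q i) (f - cst X c)^-1 /\
    (openball (q i) (f - cst X c)^-1 <-> ~ unitball (q i) f).
Proof.
pose bad i := [set c | abs c <= 1 /\ openball (q i) (f - cst X c)].
pose bc i := xget 0 (bad i).
have bc1 j : abs (bc j) <= 1.
  by rewrite /bc; case: xgetP => [c _ []|_] //; rewrite abs0 // ler01.
have [d|c c1 hc] := @fresh_residue _ _ _ hav [seq bc j | j <- enum I].
  by case/mapP => j _ ->.
exists c => // i; have [Vf|nV] := pselect (unitball (q i) f); last first.
  have [Vfc|Mw] := unitballV (q i) (f - cst X c); last first.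
    by split; [exact: open_unitball | split].
  case: nV; rewrite -(subrK (cst X c) f); apply: unitballD => //.
  exact: unitball_cst.
have [Ofc fc1] := unitballB Vf (unitball_cst (q i) c1).
suff N1 : seminorm (q i) (f - cst X c) = 1.
  have [|OV NV] := seminorm_inv Ofc; first by rewrite N1 oner_neq0.
  rewrite N1 invr1 in NV; rewrite /unitball /openball NV lexx ltxx.
  by split; [|split=> [[]|/(_ Vf)]].
apply/eqP; rewrite eq_le fc1 /= leNgt; apply/negP => lt1.
have [_ bad_i] : bad i (bc i) by apply: (@xgetI _ _ _ c); split.
have : abs (c - bc i) < 1; last by rewrite hc ?ltxx // map_f // mem_enum.
have [_] := openballB bad_i (conj Ofc lt1).
by rewrite opprB addrC addrA subrK -rmorphB seminorm_cst.
Qed.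

End Extensionality.

(** * Transitivity of the Galois group on fibres *)

Section GaloisAction.
Variables (X : curve k) (L : splittingFieldType X).
Local Notation gT := (gal_of {:L}%AS).
Implicit Types (s : gT) (q : anpoint abs (cover_curve L)).

Lemma gal_cst s c : s (cst (cover_curve L) c) = cst (cover_curve L) c.
Proof.
rewrite /= /cover_cst /=.
by rewrite linearZ rmorph1.
Qed.

Definition gal_mor s : curve_mor (cover_curve L) (cover_curve L) :=
  @CurveMor k (cover_curve L) (cover_curve L) s (gal_cst s).

(** Products in [gal_of] apply the left factor first, so that pulling seminorms back is a left
    action. *)
Definition galact s q : anpoint abs (cover_curve L) := anmap (gal_mor s) q.

Lemma galact1 q : galact 1%g q = q.
Proof.
by apply: anpoint_eq; apply/funext => f /=; rewrite gal_id.
Qed.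

Lemma galactM s t q : galact (s * t)%g q = galact s (galact t q).
Proof.
by apply: anpoint_eq; apply/funext => f /=; rewrite galM ?memvf.
Qed.

Lemma galactK s : cancel (galact s) (galact s^-1%g).
Proof. by move=> q; rewrite -galactM mulVg galact1. Qed.

Lemma anmap_galact s q :
  anmap (cover_mor L) (galact s q) = anmap (cover_mor L) q.
Proof.
apply: anpoint_eq; apply/funext => f /=.
  by rewrite linearZ rmorph1.
by rewrite linearZ rmorph1.
Qed.

(** [s] has finite order: iterating the inclusion leads back to [q], so it cannot be strict. *)
Lemma galact_sub s q :
  unitball q `<=` unitball (galact s q) -> unitball (galact s q) `<=` unitball q.
Proof.
move=> Vs f Vf; have h n : unitball q ((s ^+ n.+1)%g f).
  elim: n => [|n IH]; first by rewrite expg1.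
  by rewrite expgSr galM ?memvf //; apply: Vs.
have := h #[s]%g.-1; rewrite prednK ?order_gt0 // expg_order gal_id.
by [].
Qed.

(* Otherwise there is a unit of all conjugates of [unitball q1] that lies in
   [openball q2]; but its norm is in the base field, where both agree. *)
Lemma galact_dominated q1 q2 : galois 1%VS {:L}%VS ->
    anmap (cover_mor L) q1 = anmap (cover_mor L) q2 ->
  exists s, unitball (galact s q1) `<=` unitball q2.
Proof.
move=> galL E; apply: contrapT => nex.
have {}nex s : exists2 f, unitball (galact s q1) f & ~ unitball q2 f.
  apply: contrapT => nf; apply: nex; exists s => f Vf.
  by apply: contrapT => nV; apply: nf; exists f.
(* Integrality at all conjugates of both points bounds every factor of the norm by 1. *)
pose P f := (forall s, unitball (galact s q1) f /\ unitball (galact s q2) f) /\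
            openball q2 f.
have [|f g c c1 [Vf Mf] [Vg Mg]|s f g|s c f c1|s|f [Vf Mf] nM] :=
  @avoidance L (cst (cover_curve L)) gT P (fun s => openball (galact s q1)).
- split=> [s|]; last by rewrite /openball seminorm0 ltr01; split=> //; exact: locring0.
  by rewrite /unitball !seminorm0 ler01; do !split; exact: locring0.
- have Vc q : unitball q (cst (cover_curve L) (- c)).
    by apply: unitball_cst; rewrite absN.
  rewrite -[_ * g]opprK -mulNr -rmorphN; split=> [s|].
    have [[? ?] [? ?]] := (Vf s, Vg s).
    by split; apply: unitballB => //; apply: unitballM.
  by apply: openballB => //; apply: openballM.
- exact: openballB.
- by apply: openballM; apply: unitball_cst.
(* Both orbits are treated at once, so [(f - c)^-1] is integral at all their points. It is small at
   [q2], where [f] is not integral, but not at [galact s q1], where [f] is. *)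
- have [f Vf nV] := nex s.
  have [c c1 hc] := @inv_shift (cover_curve L) (gT * bool)%type
    (fun z => galact z.1 (if z.2 then q1 else q2)) f.
  exists (f - cst (cover_curve L) c)^-1; last by case: (hc (s, true)) => _ [+ _] => /[apply].
  split=> [t|]; first by case: (hc (t, true)) (hc (t, false)) => /= ? _ [].
  by have [_ [_]] := hc (1%g, false); rewrite /= galact1; apply.
have Nm : galNorm 1 {:L} f \in 1%VS by apply: mem_galNorm => //; apply: memvf.
have /vlineP [z zE] := Nm.
have Of1 s : locring q1 (s f) by have [[]] := Vf s.
have Of2 s : locring q2 (s f) by have [_ []] := Vf s.
have N1 s : seminorm q1 (s f) = 1.
  have [[_ le1] _] := Vf s; apply/eqP; rewrite eq_le le1 /= leNgt; apply/negP => lt1.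
  by apply: (nM s); split=> //; exact: Of1.
have N12 : seminorm q1 (galNorm 1 {:L} f) = seminorm q2 (galNorm 1 {:L} f).
  by rewrite zE; exact: (congr1 (fun p => seminorm p z) E).
have N1n : seminorm q1 (galNorm 1 {:L} f) = 1.
  have [_ ->] := @seminorm_prod _ q1 _ (index_enum gT)
    (fun s => s \in 'Gal({:L} / 1)%g) (fun s => s f) (fun s _ => Of1 s).
  by rewrite big1.
suff : seminorm q2 (galNorm 1 {:L} f) < 1 by rewrite -N12 N1n ltxx.
have [_ ->] := @seminorm_prod _ q2 _ (index_enum gT)
  (fun s => s \in 'Gal({:L} / 1)%g) (fun s => s f) (fun s _ => Of2 s).
rewrite (bigD1 1%g) ?group1 //= gal_id mulrC.
apply: mulr_ile_lt1; rewrite ?seminorm_ge0 ?prodr_ge0 //; last by case: Mf.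
- by move=> s _; apply: seminorm_ge0.
- by apply: prodr_ile1 => s _; rewrite seminorm_ge0; have [_ []] := Vf s.
Qed.

(** Domination in both directions places [q2] between two points of the orbit of [q1]; by
    [galact_sub] these coincide. *)
Lemma galact_trans q1 q2 : galois 1%VS {:L}%VS ->
    anmap (cover_mor L) q1 = anmap (cover_mor L) q2 ->
  exists s, q2 = galact s q1.
Proof.
move=> galL E; have [s Vs] := galact_dominated galL E.
have [t Vt] := galact_dominated galL (esym E).
have Vst : unitball q2 `<=` unitball (galact t^-1%g q1).
  move=> f Vf; apply: (Vt (t^-1%g f)).
  by rewrite -[unitball _ _]/(unitball (galact t^-1%g (galact t q2)) f) galactK.
have Es : galact t^-1%g q1 = galact (t^-1 * s^-1)%g (galact s q1).
  by rewrite -galactM mulgKV.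
have Vs' := subset_trans Vs Vst; rewrite Es in Vs' Vst.
exists s; apply: unitball_inj => //.
exact: subset_trans Vst (galact_sub Vs').
Qed.

End GaloisAction.

(** * Local rings of closed points *)

Lemma poly_shiftX (D : nzRingType) (P : {poly D}) B :
  (size P <= B.+1)%N -> P`_0 = 0 -> P = (\poly_(l < B) P`_l.+1) * 'X.
Proof.
move=> sP P0; apply/polyP => -[|l]; rewrite coefMX //= coef_poly.
by case: ltnP => // h; rewrite nth_default // (leq_trans sP).
Qed.

Section ClosedPoint.
Variables (X : curve k) (q : anpoint abs X).
Local Notation O := (locring q).
Local Notation N := (seminorm q).
Local Notation "P .{ t }" := (map_poly (cst X) P).[t] (at level 2, format "P .{ t }").

Definition maxideal f := O f /\ N f = 0.

Lemma maxidealB f g : maxideal f -> maxideal g -> maxideal (f - g).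
Proof.
move=> [Of f0] [Og g0]; split; first exact: locringB.
by apply/le_anti; rewrite seminorm_ge0 seminormB_le ?f0 ?g0.
Qed.

Lemma maxidealM f g : O f -> maxideal g -> maxideal (f * g).
Proof.
by move=> Of [Og g0]; split; [exact: locringM | rewrite seminormM // g0 mulr0].
Qed.

Lemma maxideal0 : maxideal 0.
Proof. by split; [exact: locring0 | exact: seminorm0]. Qed.

Lemma maxidealN f : maxideal f -> maxideal (- f).
Proof. by rewrite -sub0r; apply/maxidealB/maxideal0. Qed.

Lemma maxideal_sum (I : Type) (r : seq I) (P : pred I) (F : I -> X) :
  (forall i, P i -> maxideal (F i)) -> maxideal (\sum_(i <- r | P i) F i).
Proof.
apply: (big_ind maxideal maxideal0) => f g mf /maxidealN mg.
by rewrite -[g]opprK; apply: maxidealB.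
Qed.

Lemma maxideal_cst c : maxideal (cst X c) -> c = 0.
Proof. by move=> [_]; rewrite seminorm_cst => /eqP; rewrite abs_eq0 // => /eqP. Qed.

Lemma maxidealV f : O f \/ maxideal f^-1.
Proof.
have [Of|nOf] := pselect (O f); [by left | right].
have [//|OV] := locringV q f; split=> //.
by apply: seminorm_nonunit => //; rewrite invrK.
Qed.

Lemma maxideal_inv f : f != 0 -> maxideal f -> ~ O f^-1.
Proof. by move=> f0 [Of Nf] /(seminorm_neq0 f0 Of); rewrite Nf eqxx. Qed.

Lemma horner_maxideal t (P : {poly k}) : maxideal t ->
  O P.{t} /\ maxideal (P.{t} - cst X P`_0).
Proof.
move=> mt; elim/poly_ind: P => [|P c [OP _]].
  by rewrite rmorph0 horner0 coef0 rmorph0 subrr; split; [exact: locring0|exact: maxideal0].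
have mPt : maxideal (P.{t} * t) by apply: maxidealM.
have -> : (P * 'X + c%:P).{t} = P.{t} * t + cst X c.
  by rewrite rmorphD rmorphM /= map_polyX map_polyC !hornerE.
rewrite coefD coefMX coefC eqxx add0r addrK; split=> //.
by apply: locringD; [case: mPt | apply: locring_cst].
Qed.

Lemma horner_unit t (P : {poly k}) : maxideal t -> P`_0 != 0 ->
  ~ maxideal P.{t} /\ O P.{t}^-1.
Proof.
move=> mt P0; have [OP mP] := horner_maxideal P mt.
have nm : ~ maxideal P.{t}.
  move=> /maxidealB /(_ mP); rewrite opprB addrC subrK.
  by move=> /maxideal_cst/eqP; apply/negP.
split=> //; apply: contrapT => /(seminorm_nonunit OP) N0.
by apply: nm.
Qed.

(* In a relation with coefficients in [k[t]], not all divisible by [t], the last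
   term whose coefficient is nonzero at [t = 0] would dominate all others. *)
Lemma no_long_chain t n (x : 'I_n -> X) :
    maxideal t -> t != 0 -> dependent_over (cst X) t n ->
    (forall i, maxideal (x i)) -> (forall i, x i != 0) ->
    (forall i, O (t / x i)) ->
    (forall i j : 'I_n, (i < j)%N -> maxideal (x i / x j)) ->
  False.
Proof.
move=> mt t0 dep mx x0 tx xx; have [phi [i0 phi0] E] := dep x.
suff h B (psi : 'I_n -> {poly k}) : (forall i, (size (psi i) <= B)%N) ->
    \sum_i (psi i).{t} * x i = 0 -> forall i, psi i = 0.
  by move/eqP: phi0; apply; apply: h E i0 => i; apply: (@leq_bigmax _ (fun i => size (phi i))).
elim: B psi => [|B IH] {phi i0 phi0 E} phi szB E i.
  by apply/eqP; rewrite -size_poly_leq0.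
(* If [t] divides all coefficients, cancelling it lowers the bound [B]. *)
have [/existsP[j0 phij0]|] := boolP [exists j, (phi j)`_0 != 0]; last first.
  rewrite negb_exists => /forallP phi0.
  pose psi j := \poly_(l < B) (phi j)`_l.+1.
  have psiE j : phi j = psi j * 'X by apply: poly_shiftX => //; apply/eqP/negPn.
  rewrite psiE (IH psi) ?mul0r // => [j|]; first exact: size_poly.
  apply: (mulIf t0); rewrite mul0r -[RHS]E mulr_suml; apply: eq_bigr => j _.
  by rewrite [in RHS]psiE rmorphM hornerM /= map_polyX hornerX mulrAC.
have [j phij jmax] := @arg_maxnP _ j0 (fun j => (phi j)`_0 != 0) val phij0.
have [+ _] := horner_unit mt phij; case.
have -> : (phi j).{t} = - \sum_(i | i != j) (phi i).{t} * x i / x j.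
  apply: (mulIf (x0 j)); apply/eqP; rewrite -subr_eq0 mulNr opprK mulr_suml.
  rewrite -[X in _ == X]E [X in _ == X](bigD1 j) //=; apply/eqP; congr (_ + _).
  by apply: eq_bigr => l _; rewrite mulfVK.
apply/maxidealN/maxideal_sum => l lj.
have [Ol ml] := horner_maxideal (phi l) mt.
(* Before [j], the chain makes [x l] smaller than [x j]. After [j], the coefficient has a factor
   [t], which [x j] divides, and [x l] is itself in the maximal ideal. *)
have [lt|] := ltnP l j; first by rewrite -mulrA; apply/maxidealM/xx.
rewrite leq_eqVlt => /orP[/eqP/val_inj jl|jl]; first by rewrite jl eqxx in lj.
have phil0 : (phi l)`_0 = 0.
  by apply/eqP; apply: contraTT jl => /jmax; rewrite -leqNgt.
pose psi := \poly_(l' < B) (phi l)`_l'.+1.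
have psiE : phi l = psi * 'X by apply: poly_shiftX.
have -> : (phi l).{t} * x l / x j = psi.{t} * (t / x j) * x l.
  by rewrite psiE rmorphM hornerM /= map_polyX hornerX; field.
apply: maxidealM => //; apply: locringM => //.
by have [] := horner_maxideal psi mt.
Qed.

Hypothesis Iq : type_I q.

(** Inverting a transcendental generator, or subtracting its value at [q], makes it vanish at [q]
    without changing the subfield [k(t)]. *)
Lemma exists_parameter : exists t n,
  [/\ maxideal t, t != 0 & dependent_over (cst X) t n].
Proof.
have [t0 t0P [s sP]] := curveP X.
have dep := spanned_dependent sP.
have [Ot|mt] := maxidealV t0; last first.
  have t00 : t0 != 0.
    by have := t0P 'X; rewrite map_polyX hornerX; apply; rewrite polyX_eq0.
  by exists t0^-1, (size s).+1; rewrite invr_eq0; split=> //; exact: dependent_inv.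
have [c Nc] := Iq Ot; exists (t0 - cst X c), (size s).+1; split.
- by split=> //; apply: locringB => //; exact: locring_cst.
- have := t0P ('X - c%:P); rewrite rmorphB /= map_polyX map_polyC !hornerE.
  by apply; rewrite polyXsubC_eq0.
- exact: dependent_shift.
Qed.

(** Otherwise every nonzero element of the maximal ideal is a product of two others; factoring the
    parameter again and again gives chains of any length, against [no_long_chain]. *)
Lemma exists_uniformizer : exists u, uniformizer q u.
Proof.
apply: contrapT => nu; have [t [n [mt t0 dep]]] := exists_parameter.
have nxt u : exists f, u != 0 /\ maxideal u ->
    [/\ f != 0, maxideal f & maxideal (u / f)].
  have [[u0 mu]|?] := pselect (u != 0 /\ maxideal u); last by exists 0.
  apply: contrapT => nf; apply: nu; exists u; split=> //; try by case: mu.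
  move=> f Of Nf; apply: contrapT => nO; apply: nf; exists f => _.
  have f0 : f != 0.
    by apply: contra_notN nO => /eqP ->; rewrite mul0r; exact: locring0.
  by have [//|] := maxidealV (f / u); rewrite invf_div.
have [nx nxP] := choice nxt.
pose x i := iter i nx t.
have xP i : x i != 0 /\ maxideal (x i).
  by elim: i => [//|i /(nxP _)[]].
have xx i d : maxideal (x i / x (i + d.+1)%N).
  elim: d => [|d IH]; first by rewrite addn1; case: (nxP _ (xP i)).
  have [_ _ m] := nxP _ (xP (i + d.+1)%N).
  have -> : x i / x (i + d.+2)%N = x i / x (i + d.+1)%N * (x (i + d.+1)%N / x (i + d.+2)%N).
    by rewrite mulrA mulfVK //; case: (xP (i + d.+1)%N).
  by rewrite [(i + d.+2)%N]addnS; apply: maxidealM => //; case: IH.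
apply: (@no_long_chain t n (fun i => x i)) => // i; try by case: (xP i).
- case: (nat_of_ord i) => [|d]; first by rewrite divff //; exact: locring1.
  by case: (xx 0%N d); rewrite add0n.
- move=> j ij; have := xx i (j - i.+1)%N.
  by rewrite -subSn // subSS subnKC // ltnW.
Qed.

Lemma maxideal_unif u f : uniformizer q u -> maxideal f -> O (f / u).
Proof. by case=> _ _ _ h [Of Nf]; apply: h. Qed.

Lemma uniformizer_maxideal u : uniformizer q u -> maxideal u.
Proof. by case. Qed.

(** An element divisible by all powers of [u] would, being algebraic over [k(t)], divide some power
    of [t]; but [t] is not divisible by [u ^+ n]. *)
Lemma unif_archimedean u f : uniformizer q u -> f != 0 ->
  exists n, ~ O (f / u ^+ n).
Proof.
move=> uP f0; have mu := uniformizer_maxideal uP; have [u0 Ou _ _] := uP.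
have [t [n [mt t0 dep]]] := exists_parameter.
(* Otherwise [u ^+ n, ..., u] would be a chain of forbidden length [n]. *)
have tn : ~ O (t / u ^+ n).
  move=> tn; apply: (@no_long_chain t n (fun i => u ^+ (n - i))) => // i.
  - by rewrite -(subnSK (ltn_ord i)) exprS mulrC; apply: maxidealM => //; exact: locringX.
  - by rewrite expf_neq0.
  - have -> : t / u ^+ (n - i) = t / u ^+ n * u ^+ i.
      have -> : u ^+ n = u ^+ (n - i) * u ^+ i by rewrite -exprD subnK // ltnW.
      by field; rewrite !expf_neq0.
    by apply: locringM => //; exact: locringX.
  - move=> j ij; have -> : u ^+ (n - i) / u ^+ (n - j) = u ^+ (j - i.+1) * u.
      rewrite -exprSr subnSK //.
      have -> : (n - i = (j - i) + (n - j))%N by have := ltn_ord j; lia.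
      by rewrite exprD mulfK ?expf_neq0.
    by apply: maxidealM => //; exact: locringX.
apply: contrapT => nex; have {nex} fu m : O (f / u ^+ m).
  by apply: contrapT => h; apply: nex; exists m.
have Of : O f by have := fu 0%N; rewrite expr0 divr1.
(* With [j] the least index of a nonzero coefficient, dividing the relation by [f ^+ j.+1] shows
   that [f] divides [phi j] evaluated at [t], which is a power of [t] times a unit. *)
have [phi [i phi0] E] := dep (fun i => f ^+ i).
have [j phij jmin] := @arg_minnP _ i (fun j => phi j != 0) val phi0.
have Of_phi : O ((phi j).{t} / f).
  have -> : (phi j).{t} / f
      = - \sum_(l | l != j) (phi l).{t} * (f ^+ l / f ^+ j / f).
    have fj : f ^+ j * f != 0 by rewrite mulf_neq0 // expf_neq0.
    have Ej : (phi j).{t} / f * (f ^+ j * f) = (phi j).{t} * f ^+ j by field.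
    apply: (mulIf fj); apply/eqP; rewrite Ej mulNr -subr_eq0 opprK.
    rewrite -[X in _ == X]E [X in _ == X](bigD1 j) //=; apply/eqP; congr (_ + _).
    rewrite mulr_suml; apply: eq_bigr => l _; field; rewrite f0 expf_neq0 //.
  apply/locringN/locring_sum => l lj; have [Ol _] := horner_maxideal (phi l) mt.
  have [/eqP ->|phil] := boolP (phi l == 0).
    by rewrite rmorph0 horner0 mul0r; exact: locring0.
  have jl : (j < l)%N.
    by rewrite ltn_neqAle jmin // andbT; apply: contraNneq lj => /val_inj ->.
  apply: locringM => //; suff -> : f ^+ l / f ^+ j / f = f ^+ (l - j.+1).
    exact: locringX.
  by rewrite -mulrA -invfM -exprSr -{1}(subnK jl) exprD mulfK ?expf_neq0.
have [s Os] : exists s, O (t ^+ s / f).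
  have [s [p /implyP/(_ phij) p0 pE]] := multiplicity_XsubC (phi j) 0.
  exists s; have p00 : p`_0 != 0 by rewrite -horner_coef0 -rootE.
  have [nmp OV] := horner_unit mt p00.
  have -> : t ^+ s / f = (phi j).{t} / f / p.{t}.
    rewrite pE rmorphM rmorphXn hornerM horner_exp /= rmorphB /=.
    rewrite map_polyX map_polyC !hornerE /= rmorph0 subr0.
    have pt0 : p.{t} != 0.
      by apply: contra_notN nmp => /eqP ->; exact: maxideal0.
    by field; rewrite pt0 f0.
  exact: locringM.
have [//|mVt] := maxidealV (t / u ^+ n); rewrite invf_div in mVt.
apply: (@maxideal_inv u) => //.
have -> : u^-1 = (u ^+ n / t) ^+ s * (t ^+ s / f) * (f / u ^+ (n * s).+1).
  rewrite expr_div_n exprS exprM; field.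
  by rewrite u0 f0 !expf_neq0.
apply: locringM => //; apply: locringM => //; apply: locringX.
by case: mVt.
Qed.

Lemma order_exists u f : uniformizer q u -> O f -> f != 0 ->
  exists n, O (f / u ^+ n) /\ O (u ^+ n / f).
Proof.
move=> uP Of f0.
have ex : exists n, `[< ~ O (f / u ^+ n.+1) >].
  have [[|n] h] := unif_archimedean uP f0; last by exists n; apply/asboolP.
  by case: h; rewrite expr0 divr1.
case: (ex_minnP ex) => n /asboolP nO nmin; exists n.
have On : O (f / u ^+ n).
  case: n nO nmin => [_ _|n nO nmin]; first by rewrite expr0 divr1.
  by apply: contrapT => /asboolP /nmin; rewrite ltnn.
split=> //; apply: contrapT => h; apply: nO.
have : maxideal (f / u ^+ n).
  by split=> //; apply: seminorm_nonunit => //; rewrite invf_div.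
move=> /(maxideal_unif uP); congr O.
by rewrite exprS invfM [u^-1 * _]mulrC mulrA.
Qed.

End ClosedPoint.

Lemma exists_dominating (X : curve k) (q : anpoint abs X) (s : seq X) :
  has (fun a => a != 0) s -> exists2 b, b \in s & b != 0 /\
    forall a, a \in s -> locring q (a / b).
Proof.
elim: s => [//|a s IH] /=.
have [/IH [b bs [b0 bO]] _|/hasPn s0] := boolP (has _ s); last first.
  rewrite orbF => a0; exists a; first exact: mem_head.
  split=> // c; rewrite inE => /orP[/eqP ->|/s0].
    by rewrite divff //; exact: locring1.
  by rewrite negbK => /eqP ->; rewrite mul0r; exact: locring0.
have [Oab|mba] := maxidealV q (a / b).
  exists b; first by rewrite inE bs orbT.
  by split=> // c; rewrite inE => /orP[/eqP ->|/bO].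
have [a0|a0] := eqVneq a 0.
  exists b; first by rewrite inE bs orbT.
  split=> // c; rewrite inE => /orP[/eqP ->|/bO //].
  by rewrite a0 mul0r; exact: locring0.
rewrite invf_div in mba.
exists a; first exact: mem_head.
split=> // c; rewrite inE => /orP[/eqP ->|/bO Oc].
  by rewrite divff //; exact: locring1.
have -> : c / a = c / b * (b / a) by field; rewrite a0.
by apply: locringM => //; case: mba.
Qed.

(** For nonzero elements this is equality of orders at [q]. As [f / 0 = 0], everything is associate
    to 0, so transitivity asks for a nonzero middle term. *)
Definition associate (X : curve k) (q : anpoint abs X) f g :=
  locring q (f / g) /\ locring q (g / f).

Section Associates.
Variables (X : curve k) (q : anpoint abs X).

Lemma associate_sym f g : associate q f g -> associate q g f.
Proof. by case. Qed.

Lemma associateM f1 g1 f2 g2 : associate q f1 g1 -> associate q f2 g2 ->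
  associate q (f1 * f2) (g1 * g2).
Proof.
move=> [h1 h2] [h3 h4]; split.
  by rewrite invfM mulrACA; apply: locringM.
by rewrite invfM mulrACA; apply: locringM.
Qed.

Lemma associate1 f : f != 0 -> associate q f f.
Proof. by move=> f0; split; rewrite divff //; exact: locring1. Qed.

Lemma associate11 : associate q 1 1.
Proof. by apply: associate1; exact: oner_neq0. Qed.

Lemma associateX f g n : associate q f g -> associate q (f ^+ n) (g ^+ n).
Proof.
move=> h; elim: n => [|n IH]; first exact: associate11.
by rewrite !exprS; apply: associateM.
Qed.

Lemma associate_trans g f h : g != 0 ->
  associate q f g -> associate q g h -> associate q f h.
Proof.
move=> g0 [h1 h2] [h3 h4]; split.
  by rewrite -(mulfVK g0 f) -mulrA; apply: locringM.
by rewrite -(mulfVK g0 h) -mulrA; apply: locringM.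
Qed.

Lemma associate_prod (I : finType) (F G : I -> X) :
  (forall i, associate q (F i) (G i)) ->
  associate q (\prod_i F i) (\prod_i G i).
Proof.
move=> h; elim/big_rec2: _ => [|i y z _]; first exact: associate11.
exact: associateM.
Qed.

Lemma associate_unif_inj u i j : uniformizer q u ->
  associate q (u ^+ i) (u ^+ j) -> i = j.
Proof.
move=> uP; have mu := uniformizer_maxideal uP; have [u0 Ou _ _] := uP.
wlog ij : i j / (i <= j)%N.
  move=> h a_ij; case/orP: (leq_total i j) => le; first exact: h.
  by apply/esym/h => //; exact: associate_sym.
move=> [h _]; apply/eqP; rewrite eqn_leq ij leqNgt /=; apply/negP => lt.
apply: (maxideal_inv u0 mu).
have -> : u^-1 = u ^+ i / u ^+ j * u ^+ (j - i.+1).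
  rewrite -{1}(subnKC lt) exprD exprS; field.
  by rewrite u0 !expf_neq0.
by apply: locringM => //; exact: locringX.
Qed.

End Associates.

(** * Stabilizers and ramification *)

(** Let [c] be the value of [f] at [q2]. Since [f - c] is not invertible at [q2], or is 0, it cannot
    be invertible in the smaller ring, so [f] has value [c] at [q1] too. *)
Lemma typeI_sub (X : curve k) (q1 q2 : anpoint abs X) : type_I q2 ->
  locring q1 `<=` locring q2 -> unitball q1 `<=` unitball q2.
Proof.
move=> I2 sub f [Of f1]; have O2 := sub _ Of; split=> //.
have [c Nc] := I2 _ O2.
have Oc : locring q2 (f - cst X c) by apply: locringB => //; exact: locring_cst.
have c1 : abs c <= 1.
  rewrite -(seminorm_cst q1).
  have -> : cst X c = f - (f - cst X c) by rewrite opprB addrC subrK.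
  have Oc1 : locring q1 (f - cst X c) by apply: locringB => //; exact: locring_cst.
  suff N1 : seminorm q1 (f - cst X c) = 0.
    by have [] // := @unitballB _ q1 f (f - cst X c); split; rewrite ?N1 ?ler01.
  have [->|fc0] := eqVneq (f - cst X c) 0; first exact: seminorm0.
  by apply: (seminorm_nonunit Oc1) => /sub; exact: (maxideal_inv fc0 (conj Oc Nc)).
rewrite -[f](subrK (cst X c)); have [] // : unitball q2 (f - cst X c + cst X c).
apply: unitballD; last exact: unitball_cst.
by split=> //; rewrite Nc ler01.
Qed.

Section Ramification.
Variables (X : curve k) (L : splittingFieldType X).
Hypothesis galL : galois 1%VS {:L}%VS.
Local Notation gT := (gal_of {:L}%AS).
Local Notation Y := (cover_curve L).
Variable y : anpoint abs Y.
Hypothesis Iy : type_I y.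
Local Notation stab := [set s : gT | galact s y == y]%SET.

Lemma stabP (s : gT) : reflect (galact s y = y) (s \in stab).
Proof. by rewrite inE; apply: eqP. Qed.

Lemma stab_locring (s : gT) f : s \in stab -> locring y f -> locring y (s f).
Proof. by move=> /stabP {1}<-. Qed.

Lemma stab_maxideal (s : gT) f : s \in stab -> maxideal y f -> maxideal y (s f).
Proof. by move=> /stabP {1}<-. Qed.

Lemma stabV (s : gT) : s \in stab -> s^-1%g \in stab.
Proof. by move=> /stabP E; apply/stabP; rewrite -{1}E galactK. Qed.

(** Otherwise, after scaling by constants, the local rings would be included in one another;
    [typeI_sub] and [galact_sub] turn this into equality of the points. *)
Lemma separate (s : gT) : s \notin stab ->
  exists2 f, unitball (galact s y) f & ~ locring y f.
Proof.
move=> /stabP sy; apply: contrapT => nf; apply: sy.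
have sub : locring (galact s y) `<=` locring y.
  move=> f Of; apply: contrapT => nO; apply: nf.
  have [c cf] := abs_unbounded hav habs1 (seminorm (galact s y) f).
  have ac0 : 0 < abs c by apply: le_lt_trans cf; exact: seminorm_ge0.
  have c0 : c != 0 by rewrite -(abs_eq0 hav) gt_eqF.
  have Oc : locring (galact s y) (cst Y c^-1) by exact: locring_cst.
  exists (f * cst Y c^-1).
    split; first exact: locringM.
    by rewrite seminormM // seminorm_cst absV // ler_pdivrMr // mul1r ltW.
  move=> Ofc; apply: nO; rewrite -[f]mulr1 -(rmorph1 (cst Y)) -(mulVf c0).
  by rewrite rmorphM mulrA; apply: locringM => //; exact: locring_cst.
have V := typeI_sub Iy sub.
apply: unitball_inj => //.
by have := @galact_sub X L s^-1%g (galact s y); rewrite galactK; apply.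
Qed.

(* The norm of [f] has order [#|stab|] at [y], which is a multiple of the
   ramification index because the norm lies in the base field. *)
Lemma exists_separating_uniformizer u : uniformizer y u ->
  exists f, [/\ f != 0, associate y f u, forall s : gT, locring y (s f) &
    forall s : gT, s \notin stab -> locring y (s f)^-1].
Proof.
move=> uP; have mu := uniformizer_maxideal uP; have [u0 Ou _ _] := uP.
(* Elements of [P] vanish at [y]. Avoiding [M] excludes order at least 2 at [y], and zeros at the
   conjugates other than [y]. *)
pose P f := (forall s : gT, locring (galact s y) f) /\ maxideal y f.
pose M (s : gT) f := (s \in stab -> locring y (f / u ^+ 2)) /\
  (s \notin stab -> maxideal (galact s y) f).
have Vu : unitball y u by split=> //; case: mu => _ ->; rewrite ler01.
have mo (q : anpoint abs Y) f : maxideal q f -> openball q f.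
  by move=> [Of Nf]; split; rewrite ?Nf ?ltr01.
have [|f h c c1 [Of mf] [Oh mh]|s f h [f1 f2] [h1 h2]|s c f c1 [f1 f2]|s|f [Of mf] nM] :=
  @avoidance L (cst Y) gT P M.
- by split=> [s|]; [exact: locring0 | exact: maxideal0].
- rewrite -[_ * h]opprK -mulNr -rmorphN; split=> [s|].
    by apply: locringB => //; apply: locringM => //; exact: locring_cst.
  by apply: maxidealB => //; apply: maxidealM => //; exact: locring_cst.
- split=> ss; first by rewrite mulrBl; apply: locringB; [exact: f1|exact: h1].
  by apply: maxidealB; [exact: f2|exact: h2].
- split=> ss.
    by rewrite -mulrA; apply: locringM; [exact: locring_cst|exact: f1].
  by apply: maxidealM; [exact: locring_cst|exact: f2].
- have [ss|ss] := boolP (s \in stab).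
    (* [u] may have poles at other conjugates; [u / (u - c)] has none, and has the same order at
       [y]. *)
    have [c c1 hc] := @inv_shift Y gT (fun s => galact s y) u.
    set w := (u - cst Y c)^-1 in hc.
    have [Ow ow] : locring y w /\ ~ openball y w.
      have [[Ow _] ow] := hc 1%g; rewrite galact1 in Ow ow; split=> //.
      by move/ow; apply.
    have w0 : w != 0.
      by apply: contra_notN ow => /eqP ->; apply/mo/maxideal0.
    have uw : u * w = 1 + cst Y c * w.
      apply/eqP; rewrite -subr_eq -mulrBl mulrC; apply/eqP/mulVf.
      by rewrite -invr_eq0.
    exists (u * w).
      split=> [t|]; last by rewrite mulrC; exact: maxidealM.
      rewrite uw; apply: locringD; first exact: locring1.
      by apply: locringM; [exact: locring_cst | case: (hc t) => -[]].
    move=> [/(_ ss) + _]; have -> : u * w / u ^+ 2 = w / u by field.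
    move=> Owu; apply: ow; apply: mo; rewrite -(mulfVK u0 w).
    exact: maxidealM.
  (* The pole of [f] at [y] becomes a zero of [(f - c)^-1], which does not vanish at
     [galact s y]. *)
  have [f [Of f1] nOf] := separate ss.
  have [c c1 hc] := @inv_shift Y gT (fun s => galact s y) f.
  exists (f - cst Y c)^-1.
    split=> [t|]; first by case: (hc t) => -[].
    have [h|//] := maxidealV y (f - cst Y c); case: nOf.
    by rewrite -(subrK (cst Y c) f); apply: locringD => //; exact: locring_cst.
  move=> [_ /(_ ss)/mo]; case: (hc s) => _ [h _] /h; apply.
  by split.
have f0 : f != 0.
  apply/eqP => f0; apply: (nM 1%g); rewrite f0; split=> _; last exact: maxideal0.
  by rewrite mul0r; exact: locring0.
exists f; split=> [//||s|s ss]; last 1 first.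
- apply: contrapT => nOV; apply: (nM s); split=> [|_]; first by rewrite (negPf ss).
  split; first exact: (Of s).
  apply: (seminorm_nonunit (Of s)) => /= h; apply: nOV.
  by rewrite -fmorphV.
- have := nM 1%g => {}nM.
  have nfu : ~ locring y (f / u ^+ 2).
    move=> h; apply: nM; split=> //; rewrite inE galact1 eqxx //.
  have Ofu := maxideal_unif uP mf.
  split=> //; have [//|] := maxidealV y (u / f); rewrite invf_div.
  by move=> /(maxideal_unif uP); rewrite -mulrA -invfM.
- exact: (Of s).
Qed.

(** The stabilizer contributes one uniformizer at [y] per element, and the other conjugates of [f]
    are units there. *)
Lemma associate_norm u f : uniformizer y u -> f != 0 -> associate y f u ->
    (forall s : gT, locring y (s f)) ->
    (forall s : gT, s \notin stab -> locring y (s f)^-1) ->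
  associate y (galNorm 1 {:L} f) (u ^+ #|stab|).
Proof.
move=> uP f0 fu Of OV; have mu := uniformizer_maxideal uP.
have galT : 'Gal({:L} / 1)%g = [set: gT]%SET.
  by apply/setP => s; rewrite gal_kHom ?sub1v // k1HomE ahomWin inE.
have u0 : u != 0 by case: uP.
rewrite /galNorm galT.
have -> : u ^+ #|stab| = \prod_(s : gT) (if s \in stab then u else 1).
  by rewrite -big_mkcond prodr_const.
under eq_bigl do rewrite inE.
apply: associate_prod => s; case: ifPn => ss; last first.
  by split; rewrite ?divr1 ?div1r //; exact: OV.
apply: (@associate_trans _ y (s u)); first by rewrite fmorph_eq0.
  case: fu => h1 h2; split.
    by have := stab_locring ss h1; rewrite fmorph_div.
  by have := stab_locring ss h2; rewrite fmorph_div.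
split; first exact/(maxideal_unif uP)/stab_maxideal.
have := stab_locring ss (maxideal_unif uP (stab_maxideal (stabV ss) mu)).
by rewrite fmorph_div /= -galM ?memvf // mulVg gal_id.
Qed.

Variable e : nat.
Hypothesis ye : ram_index (cover_mor L) (anmap (cover_mor L) y) y e.
Hypothesis Ix : type_I (anmap (cover_mor L) y).

Lemma associate_pullback f g :
  associate (anmap (cover_mor L) y) f g -> associate y (f%:A : L) (g%:A : L).
Proof.
rewrite /associate /=.
have h a b : (a / b)%:A = a%:A / b%:A :> L by rewrite -!in_algE fmorph_div.
by rewrite !h.
Qed.

Lemma ram_index_le : (e <= #|stab|)%N.
Proof.
have [u [u' [v [uP u'P [Ov OvV] [v0 uE]]]]] := ye.
have [f [f0 fu Of OV]] := exists_separating_uniformizer u'P.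
have Nm := associate_norm u'P f0 fu Of OV.
have [z zE] : exists z, galNorm 1 {:L} f = z%:A.
  by apply/vlineP; apply: mem_galNorm => //; apply: memvf.
have z0 : z != 0.
  have : galNorm 1 {:L} f != 0 by rewrite galNorm_eq0.
  by rewrite zE scaler_eq0 oner_eq0 orbF.
have Oz : locring (anmap (cover_mor L) y) z.
  have [+ _] : locring y (galNorm 1 {:L} f) /\ True.
    split=> //; have [|//] := @seminorm_prod _ y _ (index_enum gT)
      (fun s => s \in 'Gal({:L} / 1)%g) (fun s => s f).
    by move=> s _; exact: Of.
  by rewrite zE.
have [s [s1 s2]] := order_exists Ix uP Oz z0.
have zu : associate y (z%:A : L) ((u ^+ s)%:A) by apply: associate_pullback.
have u'0 : u' != 0 by case: u'P.
have u0 : u != 0 by case: uP.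
have usE : (u ^+ s)%:A = v ^+ s * u' ^+ (e * s).
  by rewrite -in_algE rmorphXn /= exprM -exprMn -uE.
(* The order of the norm at [y], computed through [z] in the base field, is [e * s]. *)
have : associate y (u' ^+ #|stab|) (u' ^+ (e * s)).
  apply: (@associate_trans _ y (z%:A : L)).
  - by rewrite scaler_eq0 oner_eq0 orbF.
  - by apply: associate_sym; rewrite -zE.
  apply: (@associate_trans _ y ((u ^+ s)%:A : L)) => //.
    by rewrite scaler_eq0 oner_eq0 orbF expf_neq0.
  rewrite usE -[X in associate _ _ X]mul1r; apply: associateM.
    rewrite -(expr1n _ s); apply: associateX.
    by split; rewrite ?divr1 ?div1r.
  by apply: associate1; rewrite expf_neq0.
move/(associate_unif_inj u'P) => E.
apply: dvdn_leq; last by rewrite E dvdn_mulr.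
by apply/card_gt0P; exists 1%g; rewrite inE galact1.
Qed.

Lemma ram_index_gt0 : (0 < e)%N.
Proof.
have [u [u' [v [uP u'P [Ov OvV] [v0 uE]]]]] := ye.
rewrite lt0n; apply/eqP => e0; move: uE; rewrite e0 expr0 mulr1 /= => uE.
have [_ _ Nu _] := uP.
have : seminorm y v = 0 by rewrite -uE.
by apply/eqP/seminorm_neq0.
Qed.

(* If [e < #|stab|], some nonzero combination [T] of [stab] kills [u' ^+ j] for
   all [j < e].  Expanding along powers of [u'], [T] maps [O_y] into every
   [u ^+ n O_y] up to a bounded denominator, so [T = 0], contradicting the
   independence of automorphisms. *)
Lemma stab_le_ram : (#|stab| <= e)%N.
Proof.
have e_gt0 := ram_index_gt0.
have [u [u' [v [uP u'P [Ov OvV] [v0 uE]]]]] := ye.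
have u'0 : u' != 0 by case: u'P.
have Ou' : locring y u' by case: u'P.
have u0 : u != 0 by case: uP.
have stab1 : 1%g \in stab by rewrite inE galact1.
rewrite leqNgt; apply/negP => lt.
have [w w0 wA] := exists_left_kernel
  (\matrix_(i < #|stab|, j < e) (enum_val i : gT) (u' ^+ j)) lt.
pose c (s : gT) := w 0 (enum_rank_in stab1 s).
pose T f := \sum_(s in stab) c s * s f.
have TD f g : T (f + g) = T f + T g.
  by rewrite -big_split; apply: eq_bigr => s _; rewrite rmorphD mulrDr.
have TZ (z : X) (f : L) : T (z%:A * f) = z%:A * T f.
  rewrite mulr_sumr; apply: eq_bigr => s _.
  by rewrite !mulr_algl linearZ /= -scalerAr.
have Tu j : (j < e)%N -> T (u' ^+ j) = 0.
  move=> je; have := congr1 (fun M : 'rV_e => M 0 (Ordinal je)) wA.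
  rewrite !mxE => E; rewrite -[RHS]E /T big_enum_val.
  by apply: eq_bigr => i _; rewrite mxE /c enum_valK_in.
(* Subtracting the value [d] and dividing by [u'] raises the power; the discarded term
   [d * u' ^+ n], with [n < e], is killed by [T]. *)
have expand f n : (n <= e)%N -> locring y f ->
    exists2 h, locring y h & T f = T (u' ^+ n * h).
  elim: n => [|n IH] ne Of; first by exists f; rewrite // mul1r.
  have [h Oh ->] := IH (ltnW ne) Of.
  have [d Nd] := Iy Oh.
  have Od : locring y (h - cst Y d) by apply: locringB => //; exact: locring_cst.
  exists ((h - cst Y d) / u'); first exact: maxideal_unif.
  have -> : u' ^+ n * h = cst Y d * u' ^+ n + u' ^+ n.+1 * ((h - cst Y d) / u').
    by rewrite exprS; field.
  by rewrite TD TZ Tu // mulr0 add0r.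
(* [u' ^+ e] is [u] up to the unit [v], and [T] is linear over the base field, where [u] lives. *)
have step f : locring y f -> exists2 h, locring y h & T f = u%:A * T h.
  move=> /(expand _ _ (leqnn e)) [h Oh ->]; exists (v^-1 * h).
    exact: locringM.
  rewrite -TZ; congr T; rewrite -[u%:A]/(cover_mor L u) uE; field.
  done.
have steps f n : locring y f -> exists2 h, locring y h & T f = (u ^+ n)%:A * T h.
  elim: n => [|n IH] Of; first by exists f; rewrite // expr0 scale1r mul1r.
  have [h Oh ->] := IH Of; have [h' Oh' ->] := step _ Oh.
  by exists h' => //; rewrite mulrA -!in_algE -rmorphM -exprSr.
have unE n : (u ^+ n)%:A = v ^+ n * u' ^+ (e * n).
  by rewrite -in_algE rmorphXn /= exprM -exprMn -uE.
(* One power of [u'] clears the poles at [y] of all coefficients of [T]. *)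
have [a aP] : exists a, forall f, locring y f -> locring y (u' ^+ a * T f).
  have den s : exists a, locring y (u' ^+ a * c s).
    have [c0|c0] := eqVneq (c s) 0.
      by exists 0%N; rewrite c0 mulr0; exact: locring0.
    have [//|n nO] := @unif_archimedean Y y Iy u' (c s)^-1 u'P.
      by rewrite invr_eq0.
    exists n; have [//|[]] := maxidealV y ((c s)^-1 / u' ^+ n).
    by rewrite invf_div invrK.
  have [a aP] := choice den.
  exists (\sum_s a s)%N => f Of; rewrite mulr_sumr; apply: locring_sum => s ss.
  rewrite mulrA (bigD1 s) //= exprD mulrC.
  apply: locringM; first exact: stab_locring.
  by rewrite mulrAC; apply: locringM => //; exact: locringX.
have T0O f : locring y f -> T f = 0.
  move=> Of; apply: contrapT => /eqP Tf0.
  have [|n] := @unif_archimedean Y y Iy u' (u' ^+ a * T f) u'P.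
    by rewrite mulf_neq0 // expf_neq0.
  apply; have [h Oh ->] := steps f n Of.
  have -> : u' ^+ a * ((u ^+ n)%:A * T h) / u' ^+ n
      = u' ^+ ((e - 1) * n) * v ^+ n * (u' ^+ a * T h).
    have -> : (u ^+ n)%:A = v ^+ n * (u' ^+ ((e - 1) * n) * u' ^+ n).
      by rewrite unE -exprD -mulSnr subn1 prednK.
    by field; rewrite expf_neq0.
  apply: locringM; last exact: aP.
  by apply: locringM; exact: locringX.
(* A power of [u] makes [f] integral at [y] and passes through [T]. *)
have T0 f : T f = 0.
  have [->|f0] := eqVneq f 0; first by apply: T0O; exact: locring0.
  have [|n nO] := @unif_archimedean Y y Iy u' f^-1 u'P; first by rewrite invr_eq0.
  have Ofu : locring y (f * u' ^+ n).
    have [//|[]] := maxidealV y (f^-1 / u' ^+ n).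
    by rewrite invf_div invrK mulrC.
  have un0 : (u ^+ n)%:A != 0 :> L by rewrite scaler_eq0 oner_eq0 orbF expf_neq0.
  apply: (mulfI un0); rewrite mulr0 -TZ; apply: T0O.
  have -> : (u ^+ n)%:A * f = v ^+ n * u' ^+ ((e - 1) * n) * (f * u' ^+ n).
    have -> : (u ^+ n)%:A = v ^+ n * (u' ^+ ((e - 1) * n) * u' ^+ n).
      by rewrite unE -exprD -mulSnr subn1 prednK.
    by ring.
  by apply: locringM => //; apply: locringM; exact: locringX.
have [i wi] : exists i, w 0 i != 0.
  apply/existsP; rewrite -negb_forall; apply: contraNN w0 => /forallP h.
  by apply/eqP/rowP => i; rewrite mxE; apply/eqP.
have [||f _] := @gal_independent_contra _ L {:L}%AS (mem stab) c (enum_val i).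
- exact: enum_valP.
- by rewrite /c enum_valK_in.
- by move/eqP; apply; exact: T0.
Qed.

Lemma card_stab : #|stab| = e.
Proof. by apply/eqP; rewrite eqn_leq ram_index_le stab_le_ram. Qed.

End Ramification.

Lemma exists_ram_index (X X' : curve k) (g : curve_mor X' X) (y : anpoint abs X') :
    type_I y -> type_I (anmap g y) ->
  exists e, ram_index g (anmap g y) y e.
Proof.
move=> Iy Ix; have [u uP] := exists_uniformizer Ix.
have [u' u'P] := exists_uniformizer Iy.
have [u0 Ou _ _] := uP; have [u'0 _ _ _] := u'P.
have [||e [e1 e2]] := @order_exists X' y Iy u' (g u) u'P => //.
  by rewrite fmorph_eq0.
exists e, u, u', (g u / u' ^+ e); split=> //.
  by rewrite invf_div.
by rewrite mulf_neq0 ?invr_eq0 ?expf_neq0 ?fmorph_eq0 // mulfVK // expf_neq0.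
Qed.

(** * Existence of points above a closed point *)

Section MaximalSubring.
Variable (F : fieldType) (A : set F) (w : F).
Hypotheses (w0 : w != 0)
  (A1 : A 1) (Aw : A w^-1)
  (AB : forall f h, A f -> A h -> A (f - h))
  (AM : forall f h, A f -> A h -> A (f * h))
  (nAw : ~ A w)
  (Amax : forall B : set F, B 1 ->
    (forall f h, B f -> B h -> B (f - h)) ->
    (forall f h, B f -> B h -> B (f * h)) -> ~ B w -> A `<=` B -> B `<=` A).

Let A0 : A 0. Proof. by rewrite -(subrr 1); apply: AB. Qed.
Let AN f : A f -> A (- f). Proof. by rewrite -sub0r; apply: AB. Qed.
Let AD f h : A f -> A h -> A (f + h).
Proof. by move=> Af Ah; rewrite -[h]opprK; apply/AB/AN. Qed.
Let AX f n : A f -> A (f ^+ n).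
Proof. by move=> Af; elim: n => [|n IH]; rewrite ?expr0 // exprS; apply: AM. Qed.
Let A_sum (I : Type) (r : seq I) (f : I -> F) :
  (forall i, A (f i)) -> A (\sum_(i <- r) f i).
Proof. by move=> h; apply: (big_ind A). Qed.

Let overA (p : {poly F}) := forall i, A p`_i.

Lemma max_subring_adjoin z : ~ A z -> exists2 p : {poly F}, overA p & p.[z] = w.
Proof.
move=> nAz; pose B := [set f | exists2 p : {poly F}, overA p & p.[z] = f].
have [Bw|nBw] := pselect (B w); first exact: Bw.
have BA f : A f -> B f.
  by move=> Af; exists f%:P; rewrite ?hornerC // => i; rewrite coefC; case: ifP.
case: nAz; apply: (Amax _ _ _ nBw BA).
- exact: BA.
- move=> _ _ [p pA <-] [p' p'A <-]; exists (p - p'); last by rewrite !hornerE.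
  by move=> i; rewrite coefB; apply: AB.
- move=> _ _ [p pA <-] [p' p'A <-]; exists (p * p'); last by rewrite hornerM.
  by move=> i; rewrite coefM; apply: A_sum => j; apply: AM.
- exists 'X; last by rewrite hornerX.
  by move=> i; rewrite coefX; case: eqP.
Qed.

(** So [w^-1] lies in the Jacobson radical of [A]. Were the inverse of [s] missing, [w] would be a
    polynomial in it and [s ^+ n * w] would be in [A] for some [n]; as [s * w = w - b], descent on
    [n] puts [w] in [A]. *)
Lemma max_subring_unit b : A b -> A (1 - w^-1 * b)^-1.
Proof.
move=> Ab; set s := 1 - w^-1 * b.
have As : A s by apply/AB/AM.
have [s0|s0] := eqVneq s 0; first by rewrite s0 invr0.
apply: contrapT => /max_subring_adjoin [p pA pE]; apply: nAw.
have [n nE] : exists n, A (s ^+ n * w).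
  exists (size p); rewrite -pE horner_coef mulr_sumr; apply: A_sum => i.
  rewrite mulrCA; apply: AM => //.
  have : (i <= size p)%N by exact: ltnW.
  move: (size p) (nat_of_ord i) => d j /subnK <-.
  by rewrite exprD exprVn mulfK ?expf_neq0 //; apply: AX.
elim: n nE => [|n IH]; first by rewrite mul1r.
move=> h; apply: IH; have -> : s ^+ n * w = s ^+ n.+1 * w + s ^+ n * b.
  by rewrite exprSr /s; field.
by apply/AD/AM => //; apply: AX.
Qed.

Let rep z n := exists p : {poly F}, [/\ (size p <= n.+1)%N, overA p & p.[z] = w].

(** The equation in [z^-1] writes the unit [s] as a combination of negative powers of [z];
    multiplied by [s^-1] times the top term of [p], it replaces that term by lower ones. *)
Lemma max_subring_reduce z n m : z != 0 -> (m <= n.+1)%N ->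
  rep z n.+1 -> rep z^-1 m -> rep z n.
Proof.
move=> z0 mn [p [szp pA pE]] [p' [szp' p'A p'E]].
pose s := 1 - w^-1 * p'`_0; pose c := s^-1 * w^-1 * p`_n.+1.
have As : A s^-1 by exact: max_subring_unit.
have Ac : A c by apply: AM => //; apply: AM.
have s0 : s != 0.
  apply/eqP => /subr0_eq/(congr1 (fun x => w * x)); rewrite mulr1 mulrA divff //.
  by rewrite mul1r => wE; apply: nAw; rewrite wE.
have sE : s = \sum_(1 <= j < n.+2) w^-1 * p'`_j * z ^- j.
  have : w = \sum_(0 <= j < n.+2) p'`_j * z ^- j.
    rewrite -p'E (@horner_coef_wide _ n.+2); last exact: leq_trans szp' _.
    by rewrite big_mkord; apply: eq_bigr => j _; rewrite exprVn.
  rewrite big_nat_recl // expr0 divr1 => wE.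
  under eq_bigr do rewrite -mulrA.
  rewrite -mulr_sumr big_add1 /= -[\sum_(_ <= _ < _) _](addKr p'`_0) -wE /s.
  by field.
pose t := \poly_(i < n.+1) (p`_i + c * p'`_(n.+1 - i)).
exists t; split; first exact: size_poly.
  by move=> i; rewrite coef_poly; case: ifP => // _; apply/AD/AM.
rewrite -pE (@horner_coef_wide _ n.+1 t) ?size_poly //.
rewrite (@horner_coef_wide _ n.+2 p) // [RHS]big_ord_recr /=.
under eq_bigr => i _ do rewrite /t coef_poly ltn_ord mulrDl.
rewrite big_split /=; congr (_ + _).
have -> : p`_n.+1 * z ^+ n.+1 = s^-1 * p`_n.+1 * z ^+ n.+1 * s by field.
rewrite {2}sE mulr_sumr -(big_mkord xpredT (fun i => c * p'`_(n.+1 - i) * z ^+ i)).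
rewrite big_nat_rev /= big_add1 /= big_nat [RHS]big_nat; apply: eq_bigr => i ni.
have -> : (n.+1 - (0 + n.+1 - i.+1) = i.+1)%N by lia.
have -> : z ^+ n.+1 = z ^+ (0 + n.+1 - i.+1) * z ^+ i.+1.
  by rewrite -exprD; congr (_ ^+ _); lia.
by rewrite /c; field; rewrite expf_neq0 // s0 w0.
Qed.

(** If both fail, [w] is a polynomial in [z] and one in [z^-1]. The larger degree can always be
    lowered, yet degree 0 would put [w] in [A]. *)
Lemma max_subring_valuation z : A z \/ A z^-1.
Proof.
have no_rep N : forall n m z, (n + m <= N)%N -> z != 0 -> rep z n -> rep z^-1 m -> False.
  elim: N => [|N IH] n m {}z nm z0 rn rm.
    case: rn => p [szp pA]; rewrite (size1_polyC (leq_trans szp _)).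
      by rewrite hornerC => pw; apply: nAw; rewrite -pw.
    by move: nm; lia.
  wlog mn : n m z nm z0 rn rm / (m <= n)%N.
    move=> h; case/orP: (leq_total m n) => le; first exact: (h n m z).
    apply: (h m n z^-1) => //; rewrite ?invr_eq0 ?invrK //.
    by rewrite addnC.
  case: n nm rn mn => [|n] nm rn mn.
    case: rn => p [szp pA]; rewrite (size1_polyC szp).
    by rewrite hornerC => pw; apply: nAw; rewrite -pw.
  apply: (IH n m z) => //.
  exact: max_subring_reduce mn rn rm.
have [->|z0] := eqVneq z 0; first by left.
apply: contrapT => /not_orP[/max_subring_adjoin[p pA pE] /max_subring_adjoin[p' p'A p'E]].
apply: (@no_rep _ (size p) (size p') z (leqnn _) z0).
  by exists p; split.
by exists p'; split.
Qed.

End MaximalSubring.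

Section Extension.
Variables (X X' : curve k) (g : curve_mor X' X).
Hypothesis alg : forall f : X', exists2 P : {poly X}, P != 0 & root (map_poly g P) f.
Variable x : anpoint abs X.
Hypothesis Ix : type_I x.

Section Residue.
Variables A m : set X'.
Hypotheses (AB : forall f h, A f -> A h -> A (f - h))
  (AM : forall f h, A f -> A h -> A (f * h))
  (mB : forall f h, m f -> m h -> m (f - h))
  (mM : forall f h, A f -> m h -> m (f * h))
  (m_prime : forall f h, A f -> A h -> m (f * h) -> m f \/ m h)
  (m1 : ~ m 1)
  (Ag : forall f, locring x f -> A (g f))
  (mg : forall f, maxideal x f -> m (g f)).

(* An algebraic equation can be normalised to have integral coefficients, one
   of them 1; it then reduces to a nonzero equation over [k], which splits. *)
Lemma residue_above f : A f -> exists c, m (f - cst X' c).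
Proof.
move=> Af; have [P P0 Pf] := alg f.
have A_cst c : A (cst X' c) by rewrite -(pullback_cst g); apply/Ag/locring_cst.
have m0 : m 0 by rewrite -(rmorph0 g); apply/mg/maxideal0.
have m_sum (I : Type) (r : seq I) (F : I -> X') :
    (forall i, m (F i)) -> m (\sum_(i <- r) F i).
  move=> h; apply: (big_ind m) => // a b ma mb.
  by rewrite -[b]opprK; apply: mB => //; rewrite -sub0r; apply: mB.
have AX n : A (f ^+ n).
  elim: n => [|n IH]; last by rewrite exprS; apply: AM.
  by rewrite expr0 -(rmorph1 (cst X')).
have [|b bP [b0 bO]] := @exists_dominating X x P.
  apply/hasP; exists (lead_coef P); rewrite ?lead_coef_eq0 //.
  by rewrite mem_nth ?prednK ?lt0n ?size_poly_eq0.
have {}bO i : locring x (P`_i / b).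
  have [iP|iP] := ltnP i (size P); first by apply: bO; apply: mem_nth.
  by rewrite nth_default // mul0r; exact: locring0.
have [c cP] := choice (fun i => Ix (bO i)).
pose Q := \poly_(i < size P) c i.
have mc i : m (g (P`_i / b) - cst X' (c i)).
  rewrite -(pullback_cst g) -rmorphB; apply: mg; split=> //.
  by apply: locringB => //; exact: locring_cst.
have Q0 : Q != 0.
  have [i iP bE] : exists2 i, (i < size P)%N & P`_i = b.
    by exists (index b P); rewrite ?index_mem ?nth_index.
  apply/eqP => /(congr1 (fun p : {poly k} => p`_i)).
  rewrite coef_poly iP coef0 => ci; apply: m1.
  by have := mc i; rewrite bE divff // rmorph1 ci rmorph0 subr0.
have mQ : m (map_poly (cst X') Q).[f].
  have -> : (map_poly (cst X') Q).[f]
      = - \sum_(i < size P) (g (P`_i / b) - cst X' (c i)) * f ^+ i.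
    have -> : (map_poly (cst X') Q).[f] = \sum_(i < size P) cst X' (c i) * f ^+ i.
      rewrite (@horner_coef_wide _ (size P)) ?size_map_poly ?size_poly //.
      by apply: eq_bigr => i _; rewrite coef_map coef_poly ltn_ord.
    apply/eqP; rewrite -subr_eq0 opprK -big_split /=.
    under eq_bigr do rewrite -mulrDl addrC subrK.
    move: Pf; rewrite rootE (@horner_coef_wide _ (size P)) ?size_map_poly //.
    move=> /eqP/(congr1 (fun z => z / g b)); rewrite mul0r mulr_suml => E.
    rewrite -[X in _ == X]E; apply/eqP/eq_bigr => i _.
    by rewrite coef_map fmorph_div mulrAC.
  rewrite -sub0r; apply: mB => //; apply: m_sum => i; rewrite mulrC.
  exact: mM.
have [r rE] := closed_field_poly_normal Q.
have lQ : lead_coef Q != 0 by rewrite lead_coef_eq0.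
move: mQ; rewrite rE map_polyZ /= hornerZ rmorph_prod horner_prod.
under eq_bigr => z _ do
  rewrite rmorphB /= map_polyX map_polyC hornerXsubC /=.
move=> /(mM (A_cst (lead_coef Q)^-1)); rewrite mulrA -rmorphM mulVf // rmorph1 mul1r.
elim: r {rE} => [|z r IH]; first by rewrite big_nil.
rewrite big_cons => /m_prime; case=> //; first exact: AB.
  elim: (r) => [|z' r' IH']; first by rewrite big_nil -(expr0 f).
  by rewrite big_cons; apply: AM => //; exact: AB.
by exists z.
Qed.

End Residue.

Lemma type_I_above (y : anpoint abs X') : anmap g y = x -> type_I y.
Proof.
move=> yx f Of.
have [||||||||c [_ Nc]] // := @residue_above (locring y) (maxideal y) _ _ _ _ _ _ _ _ f Of.
- exact: locringB.
- exact: locringM.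
- exact: maxidealB.
- exact: maxidealM.
- move=> a b Oa Ob [_]; rewrite seminormM // => /eqP; rewrite mulf_eq0.
  by move=> /orP[/eqP ?|/eqP ?]; [left | right].
- by move=> [_ /eqP]; rewrite seminorm1 oner_eq0.
- by move=> h; rewrite -yx.
- by move=> h; rewrite -yx.
by exists c.
Qed.

Section PointOfValuationRing.
Variable A : set X'.
Hypotheses (AB : forall f h, A f -> A h -> A (f - h))
  (AM : forall f h, A f -> A h -> A (f * h))
  (AV : forall f, A f \/ A f^-1)
  (Ag : forall f, locring x f -> A (g f))
  (nA : forall f, maxideal x f -> f != 0 -> ~ A (g f)^-1).

Let m f := A f /\ (f = 0 \/ ~ A f^-1).

(** By [residue_above], stated for a bare pair [A], [m] because no point is available yet, every
    element of [A] has a residue [r f] in [k]; its absolute value is the seminorm. *)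
Lemma exists_point_of_valuation_ring : exists y, anmap g y = x.
Proof.
have A_cst c : A (cst X' c) by rewrite -(pullback_cst g); apply/Ag/locring_cst.
have A1 : A 1 by rewrite -(rmorph1 (cst X')).
have A0 : A 0 by rewrite -(rmorph0 (cst X')).
have AD f h : A f -> A h -> A (f + h).
  by move=> Af Ah; rewrite -[h]opprK; apply: AB => //; rewrite -sub0r; apply: AB.
have m0 : m 0 by split=> //; left.
have mM f h : A f -> m h -> m (f * h).
  move=> Af [Ah mh]; split; first exact: AM.
  have [|fh0] := eqVneq (f * h) 0; [by left | right => Afh].
  have h0 : h != 0 by apply: contraNneq fh0 => ->; rewrite mulr0.
  have f0 : f != 0 by apply: contraNneq fh0 => ->; rewrite mul0r.
  case: mh => [/eqP|]; first exact/negP.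
  by apply; have := AM Af Afh; rewrite invfM mulrA divff // mul1r.
have mB f h : m f -> m h -> m (f - h).
  have sub a b : b != 0 -> m a -> m b -> A (a / b) -> m (a - b).
    move=> b0 _ mb Aab; have -> : a - b = (a / b - 1) * b by field.
    by apply: (mM) => //; apply: AB.
  move=> mf mh; have [->|h0] := eqVneq h 0; first by rewrite subr0.
  have [->|f0] := eqVneq f 0.
    by rewrite sub0r -mulN1r; apply: (mM) => //; rewrite -sub0r; apply: AB.
  have [|Ahf] := AV (f / h); first exact: sub.
  rewrite -opprB -mulN1r; apply: (mM); first by rewrite -sub0r; apply: AB.
  by apply: sub => //; rewrite -invf_div.
have mD f h : m f -> m h -> m (f + h).
  by move=> mf mh; rewrite -[h]opprK; apply: (mB) => //; rewrite -sub0r; apply: (mB).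
have m1 : ~ m 1 by move=> [_ [/eqP|]]; rewrite ?oner_eq0 // invr1.
have m_prime f h : A f -> A h -> m (f * h) -> m f \/ m h.
  move=> Af Ah [_ mfh]; have [|nf] := pselect (m f); [by left | right].
  split=> //; apply: contrapT => /not_orP [/eqP h0 /contrapT Ah'].
  have f0 : f != 0 by apply/eqP => f0; apply: nf; rewrite f0.
  have Af' : A f^-1 by apply: contrapT => nAf; apply: nf; split=> //; right.
  case: mfh => [/eqP|]; first by rewrite mulf_eq0 (negPf f0) (negPf h0).
  by apply; rewrite invfM; apply: AM.
have mg f : maxideal x f -> m (g f).
  move=> mf; split; first by apply: Ag; case: mf.
  have [->|f0] := eqVneq f 0; first by left; rewrite rmorph0.
  by right; exact: nA.
have res f := @residue_above A m AB AM mB mM m_prime m1 Ag mg f.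
have m_cst c : m (cst X' c) -> c = 0.
  move=> mc; apply: contrapT => /eqP c0; apply: m1.
  have -> : 1 = cst X' c^-1 * cst X' c by rewrite -rmorphM mulVf // rmorph1.
  exact: mM.
pose r f := xget 0 [set c | m (f - cst X' c)].
have rE f c : m (f - cst X' c) -> r f = c.
  move=> mc; apply: xget_unique => // d md; apply/eqP; rewrite -subr_eq0.
  apply/eqP/m_cst; rewrite rmorphB.
  by have := mB _ _ mc md; rewrite opprB addrC addrA subrK.
have rP f : A f -> m (f - cst X' (r f)) by move=> /res [c mc]; rewrite (rE f c).
pose N f : R := if `[< A f >] then abs (r f) else 0.
have NE f : A f -> N f = abs (r f) by move=> /asboolP h; rewrite /N h.
have yP : is_anpoint abs A N.
  split.
  - by split.
  - by move=> f nAf; rewrite /N; case: asboolP.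
  - split=> [f Af|c]; first by rewrite NE // abs_ge0.
    by rewrite NE // (rE _ c) // subrr.
  - move=> f h Af Ah; split.
      rewrite !NE //; last exact: AM.
      rewrite -absM //; congr abs; apply: rE.
      have -> : f * h - cst X' (r f * r h)
          = f * (h - cst X' (r h)) + cst X' (r h) * (f - cst X' (r f)).
        by rewrite rmorphM; ring.
      by apply: (mD); apply: (mM) => //; exact: (rP).
    rewrite !NE //; last exact: AD.
    have -> : r (f + h) = r f + r h.
      apply: rE; rewrite rmorphD.
      have -> : f + h - (cst X' (r f) + cst X' (r h))
          = (f - cst X' (r f)) + (h - cst X' (r h)) by ring.
      by apply: (mD); exact: (rP).
    by case: hav => _ _ _; apply.
  - move=> f Af; rewrite NE //.
    have mr : r f = 0 <-> m f.
      split=> [r0|mf]; last by apply: rE; rewrite rmorph0 subr0.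
      by have := rP f Af; rewrite r0 rmorph0 subr0.
    split=> [/eqP|mf].
      by rewrite abs_eq0 // => /eqP/mr [_].
    by apply/eqP; rewrite abs_eq0 //; apply/eqP/mr.
exists (AnPoint yP).
(* If [f] is outside the local ring of [x], its inverse is in the maximal ideal, and [nA] keeps
   [g f] out of [A]. *)
have locE : locring (anmap g (AnPoint yP)) = locring x.
  apply/seteqP; split=> f /=; last exact: Ag.
  move=> Agf; have [//|mf] := maxidealV x f.
  have [->|f0] := eqVneq f 0; first exact: locring0.
  by case: (nA mf); rewrite ?invr_eq0 // fmorphV invrK.
apply: anpoint_eq => //; apply/funext => f.
have [Of|nO] := pselect (locring x f); last first.
  by rewrite !seminorm_out // locE.
have [c Nc] := Ix Of.
have Ofc : locring x (f - cst X c) by apply: locringB => //; exact: locring_cst.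
have mfc : maxideal x (f - cst X c) by [].
rewrite -[seminorm (anmap _ _) f]/(N (g f)).
rewrite NE; last exact: Ag.
rewrite (rE _ c); last by rewrite -(pullback_cst g) -rmorphB; exact: mg.
have E := seminorm_cst x c; apply/eqP; rewrite eq_le -{1}E.
apply/andP; split.
  have -> : cst X c = f - (f - cst X c) by rewrite opprB addrC subrK.
  by apply: seminormB_le => //; rewrite Nc seminorm_ge0.
have {1}-> : f = (f - cst X c) - (- cst X c) by rewrite opprK subrK.
apply: seminormB_le => //; first by apply: locringN; exact: locring_cst.
  by rewrite Nc abs_ge0.
by rewrite seminormN ?E //; exact: locring_cst.
Qed.

End PointOfValuationRing.

(** Omitting the inverse [w] of a uniformizer is what makes the maximal ring dominate the local ring
    of [x]: every element of the maximal ideal there is a multiple of [u]. *)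
Lemma exists_point_above : exists y : anpoint abs X', anmap g y = x.
Proof.
have [u uP] := exists_uniformizer Ix; have mu := uniformizer_maxideal uP.
have u0 : u != 0 by case: uP.
pose w := (g u)^-1.
have w0 : w != 0 by rewrite invr_eq0 fmorph_eq0.
pose good (A : set X') := [/\ forall f, locring x f -> A (g f),
  forall f h, A f -> A h -> A (f - h), forall f h, A f -> A h -> A (f * h) & ~ A w].
pose imO := [set g f | f in locring x].
have good_imO : good imO.
  split.
  - by move=> f Of; exists f.
  - move=> _ _ [f Of <-] [h Oh <-]; exists (f - h); last exact: rmorphB.
    exact: locringB.
  - move=> _ _ [f Of <-] [h Oh <-]; exists (f * h); last exact: rmorphM.
    exact: locringM.
  - move=> [f Of]; rewrite /w -fmorphV => /fmorph_inj fu.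
    by apply: (maxideal_inv u0 mu); rewrite -fu.
have [F FP tot|A [PA Amax]] := @Zorn_bigcup _ [set A | A = set0 \/ good A].
  have [[B [FB [b Bb]]]|nF] := pselect (exists B, F B /\ B !=set0); last first.
    left; apply/seteqP; split=> // b [B FB Bb].
    by apply: nF; exists B; split=> //; exists b.
  have gd C c : F C -> C c -> good C.
    by move=> FC Cc; have [C0|//] := FP _ FC; rewrite C0 in Cc.
  right; split.
  - by move=> f Of; exists B => //; case: (gd B b FB Bb) => h _ _ _; apply: h.
  - move=> f h [B1 FB1 Bf] [B2 FB2 Bh].
    have [s|s] := tot _ _ FB1 FB2.
      by exists B2 => //; case: (gd B2 h FB2 Bh) => _ c _ _; apply: c => //; apply: s.
    by exists B1 => //; case: (gd B1 f FB1 Bf) => _ c _ _; apply: c => //; apply: s.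
  - move=> f h [B1 FB1 Bf] [B2 FB2 Bh].
    have [s|s] := tot _ _ FB1 FB2.
      by exists B2 => //; case: (gd B2 h FB2 Bh) => _ _ c _; apply: c => //; apply: s.
    by exists B1 => //; case: (gd B1 f FB1 Bf) => _ _ c _; apply: c => //; apply: s.
  - by move=> [C FC Cw]; case: (gd C w FC Cw).
have [Ag AB AM nAw] : good A.
  case: PA => [A0|//]; case: (Amax imO); last by right.
  rewrite A0; split=> // /(_ (g 1)); apply.
  by exists 1 => //; exact: locring1.
have A1 : A 1 by rewrite -(rmorph1 g); apply/Ag/locring1.
have Aw : A w^-1 by rewrite invrK; apply/Ag; case: mu.
have maxA (B : set X') : B 1 ->
    (forall f h, B f -> B h -> B (f - h)) ->
    (forall f h, B f -> B h -> B (f * h)) -> ~ B w -> A `<=` B -> B `<=` A.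
  move=> B1 BB BM nBw sAB b Bb; apply: contrapT => nAb.
  apply: (Amax B); last first.
    by right; split=> // f Of; apply/sAB/Ag.
  split=> // sBA; exact/nAb/sBA.
apply: (@exists_point_of_valuation_ring A) => //.
  exact: max_subring_valuation w0 A1 Aw AB AM nAw maxA.
move=> f mf f0 Agf; apply: nAw.
have -> : w = (g f)^-1 * g (f / u).
  by rewrite fmorph_div mulrA mulVf ?mul1r // fmorph_eq0.
by apply: AM => //; apply/Ag/(maxideal_unif uP).
Qed.

End Extension.

(** * Equivariance of the retractions *)

(** Preimages of subbasic sets are subbasic; injectivity of the action [h] on scheme points keeps
    the removed set finite. *)
Lemma galact_continuous (X : curve k) (L : splittingFieldType X)
    (s : gal_of {:L}%AS) :
  continuous (galact s : anpoint abs (cover_curve L) -> _).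
Proof.
pose h (O : set (cover_curve L)) : set (cover_curve L) := [set f | O (s f)].
have h_inj : injective h.
  move=> U V E; apply/seteqP; suff sub U' V' : h U' = h V' -> U' `<=` V'.
    by split; apply: sub.
  move=> {}E f; have -> : f = s ((s^-1)%g f).
    by rewrite -galM ?memvf // mulVg gal_id.
  by move=> Uf; have : h V' ((s^-1)%g f) by rewrite -E.
have pre (A : set (anpoint abs (cover_curve L))) :
    an_subbase A -> an_subbase (galact s @^-1` A).
  move=> [S [f [V [finS nST fO oV AE]]]].
  exists (h @^-1` S), (s f), V; split=> //; last by rewrite AE.
  - by apply: finite_preimage => // U V' _ _; apply: h_inj.
  - by move=> p Sp; apply: (fO (galact s p)).
apply/continuousP => _ [D Dsub <-].
exists [set galact s @^-1` B | B in D].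
  move=> _ [B /Dsub [E Esub <-] <-].
  exists [fset galact s @^-1` A | A in E]%fset.
    by move=> _ /imfsetP [A /= AE ->]; apply/mem_set/pre/set_mem/Esub.
  apply/seteqP; split=> q /= qE A AE.
    by apply: (qE (galact s @^-1` A)); apply/imfsetP; exists A.
  by move: AE => /imfsetP [B' BE ->]; apply: qE.
apply/seteqP; split=> q /=.
  by move=> [_ [B DB <-] Bq]; exists B.
by move=> [B DB Bq]; exists (galact s @^-1` B) => //; exists B.
Qed.

Lemma lift_equivariant (X : curve k) (K : splittingFieldType X)
    (c : curve_mor (cover_curve K) X) (hc : forall z : X, c z = cover_mor K z)
    Sigma lam (psi : R -> anpoint abs (cover_curve K) -> anpoint abs (cover_curve K)) :
    lifted_retraction c Sigma lam psi ->
  forall (s : gal_of {:K}%AS) t q, t \in `[0, 1] ->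
  psi t (galact s q) = galact s (psi t q).
Proof.
move=> [_ lift] s t q t01.
have cs (p : anpoint abs (cover_curve K)) : anmap c (galact s p) = anmap c p.
  have cE (p' : anpoint abs (cover_curve K)) : anmap c p' = anmap (cover_mor K) p'.
    by apply: anpoint_eq; apply/funext => f /=; rewrite hc.
  by rewrite !cE anmap_galact.
have [[cont psi0 psit] _] := lift q.
have [_ uniq] := lift (galact s q).
apply/esym; apply: (uniq (fun t => galact s (psi t q))) => //; split.
- have := @within_continuous_comp _ _ _ _ _ (galact s) _ cont; apply.
  by move=> p _; apply: galact_continuous.
- by rewrite psi0.
- by move=> t' t'01; rewrite !cs; exact: psit.
Qed.

(* By normality each [z] has some [s] with [s (b z) = b (t z)]; the subspaces
   of solutions [z] are finitely many, so one of them is everything. *)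
Lemma gal_lift (C X : curve k) (F' : splittingFieldType C)
    (a : curve_mor C X) (K : splittingFieldType X)
    (b : curve_mor (cover_curve K) (cover_curve F'))
    (hab : forall z : X, b (cover_mor F' (a z)) = cover_mor K z)
    (t : gal_of {:F'}%AS) :
  exists s : gal_of {:K}%AS, forall z : F', s (b z) = b (t z).
Proof.
apply: contrapT => nex.
have [||s f g Ef Eg|s c f c1 Ef|s|z _ zM] :=
  @avoidance F' (cst (cover_curve F')) (gal_of {:K}%AS) setT
    (fun s z => s (b z) = b (t z)) => //.
- by rewrite !rmorphB /= -Ef -Eg.
- have -> : t (cst (cover_curve F') c * f) = cst (cover_curve F') c * t f.
    by rewrite -[in RHS](gal_cst t c) -rmorphM.
  rewrite !(rmorphM b) pullback_cst -Ef -[in RHS](gal_cst s c).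
  exact: rmorphM.
- apply: contrapT => ns; apply: nex; exists s => z; apply: contrapT => nz.
  by apply: ns; exists z.
(* Through [a], the minimal polynomial of [b z] over [X] becomes an equation for [z] whose
   coefficients [t] fixes; so [b (t z)] is another of its roots. *)
have [p pE] : exists p, minPoly 1 (b z) = map_poly (in_alg K) p.
  by apply/polyOver1P; exact: minPolyOver.
have evalE (w : F') : (map_poly (in_alg K) p).[b w]
    = b (map_poly (cover_mor F' \o a) p).[w].
  rewrite -horner_map -map_poly_comp; congr (_.[_]).
  by apply: eq_map_poly => x; rewrite -[in_alg K x]/(cover_mor K x) -hab.
have rz : (map_poly (cover_mor F' \o a) p).[z] = 0.
  apply/eqP; rewrite -(fmorph_eq0 b) -evalE -pE; exact: root_minPoly.
have rtz : (map_poly (cover_mor F' \o a) p).[t z] = 0.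
  rewrite -(rmorph0 t) -[in RHS]rz -horner_map -map_poly_comp; congr (_.[_]).
  by apply: eq_map_poly => x /=; rewrite linearZ rmorph1.
have rb : root (minPoly 1 (b z)) (b (t z)) by rewrite pE rootE evalE rtz rmorph0.
have [s _ sE] := normalField_root_minPoly (sub1v _) (normalFieldf 1) (memvf (b z)) rb.
by apply: (zM s).
Qed.

(** * Counting fibres *)

Lemma set_card_image (I : finType) (T : choiceType) (A : {set I}) (f : I -> T) d :
    (forall i, i \in A -> #|[set j in A | f j == f i]%SET| = d) ->
  (set_card (f @` [set` A]) * d = #|A|)%N.
Proof.
move=> dE; rewrite /set_card; set S := fset_set _.
have SP t : (t \in S) = (t \in f @` [set` A]).
  by rewrite in_fset_set //; apply: finite_image; exact: finite_finset.
have -> : #|A| = (\sum_(t <- S) #|[set j in A | f j == t]%SET|)%N.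
  under eq_bigr do rewrite -sum1_card big_mkcond /=.
  rewrite exchange_big -sum1_card big_mkcond /=; apply: eq_bigr => j _.
  under eq_bigr do rewrite inE.
  case: ifPn => jA /=; last by rewrite big1.
  rewrite -big_mkcond sum1_count (eq_count (a2 := pred1 (f j))).
    rewrite count_uniq_mem ?fset_uniq // SP; apply/eqP; rewrite eq_sym eqb1.
    by apply/mem_set; exists j.
  by move=> t; rewrite /= eq_sym.
rewrite big_seq (eq_bigr (fun=> d)) => [|t]; last first.
  by rewrite SP => /set_mem [i iA <-]; exact: dE.
by rewrite -big_seq big_const_seq count_predT iter_addn_0 mulnC.
Qed.

Section Counting.
Variables (X : curve k) (L : splittingFieldType X).
Hypothesis galL : galois 1%VS {:L}%VS.
Local Notation gT := (gal_of {:L}%AS).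
Implicit Types q : anpoint abs (cover_curve L).

Lemma card_galT : #|{: gT}| = \dim {:L}.
Proof.
have := galois_dim galL; rewrite dimv1 divn1 => ->.
apply/esym/eq_card => s; rewrite gal_kHom ?sub1v // k1HomE ahomWin.
by [].
Qed.

Lemma card_same_image q (s : gT) :
  #|[set t | galact t q == galact s q]%SET| = #|[set t | galact t q == q]%SET|.
Proof.
rewrite -[RHS](card_lcoset _ s); apply: eq_card => t.
rewrite mem_lcoset !inE galactM.
have -> : (galact s^-1%g (galact t q) == q)
    = (galact s^-1%g (galact t q) == galact s^-1%g (galact s q)) by rewrite galactK.
by rewrite (inj_eq (can_inj (galactK _))).
Qed.

Lemma an_fiberE q : an_fiber (cover_mor L) (anmap (cover_mor L) q) =
  (fun s => galact s q) @` [set` [set: gT]%SET].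
Proof.
apply/seteqP; split=> q' /=.
  by move=> /esym/(galact_trans galL) [s ->]; exists s => //=; rewrite inE.
by move=> [s _ <-]; exact: anmap_galact.
Qed.

Lemma card_fiber q :
  (n_ (cover_mor L) (anmap (cover_mor L) q) * #|[set s | galact s q == q]%SET|)%N
    = \dim {:L}.
Proof.
rewrite -card_galT -cardsT /n_ an_fiberE; apply: set_card_image => s _.
rewrite -(card_same_image q s); apply: eq_card => t.
by rewrite !inE.
Qed.

End Counting.

(** As a product equal to a positive dimension, this also rules out the default value 0 for [c_] and
    [ram]. *)
Lemma galois_fiber_count
    (C X : curve k) (F' : splittingFieldType C) (galF' : galois 1%VS {:F'}%VS)
    (a : curve_mor C X) (K : splittingFieldType X)
    (b : curve_mor (cover_curve K) (cover_curve F'))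
    (hab : forall z : X, b (cover_mor F' (a z)) = cover_mor K z)
    Sigma lam psi'' (hpsi'' : lifted_retraction
       (comp_mor (comp_mor a (cover_mor F')) b) Sigma lam psi'')
    S' psi' (hpsi' : induced_retraction b S' psi'' psi')
    S psi (hpsi : induced_retraction (comp_mor (cover_mor F') b) S psi'' psi)
    (r : R) (r01 : r \in `[0, 1]) (x : anpoint abs C) (Ix : type_I x) :
  (n_ (cover_mor F') (psi r x) *
     (c_ (cover_mor F') psi' r x * ram (cover_mor F') x))%N = \dim {:F'}.
Proof.
have alg_cover (Y : curve k) (L : splittingFieldType Y) (f : L) :
    exists2 P : {poly Y}, P != 0 & root (map_poly (in_alg L) P) f.
  have [P PE] : exists P, minPoly 1 f = map_poly (in_alg L) P.
    by apply/polyOver1P; exact: minPolyOver.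
  exists P; last by rewrite -PE root_minPoly.
  by rewrite -(map_poly_eq0 (in_alg L)) -PE monic_neq0 // monic_minPoly.
have algF' (f : cover_curve F') : exists2 P : {poly C}, P != 0 &
    root (map_poly (cover_mor F') P) f := @alg_cover C F' f.
have algK (f : cover_curve K) : exists2 P : {poly C}, P != 0 &
    root (map_poly (comp_mor (cover_mor F') b) P) f.
  have [P P0 Pf] := @alg_cover X K f; exists (map_poly a P).
    by rewrite map_poly_eq0.
  rewrite -map_poly_comp; move: Pf; congr (root _ f).
  by apply: eq_map_poly => z; exact: (esym (hab z)).
have typeI_fiber (y : anpoint abs (cover_curve F')) :
    an_fiber (cover_mor F') x y -> type_I y.
  exact: (@type_I_above _ _ (cover_mor F') algF' x Ix y).
have [q0 q0x] := exists_point_above algK Ix.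
have q0x' : anmap (cover_mor F') (anmap b q0) = x.
  by rewrite -q0x; apply: anpoint_eq.
have [y [e [yx ye ramE]]] : exists y e, [/\ an_fiber (cover_mor F') x y,
    ram_index (cover_mor F') x y e & ram (cover_mor F') x = e].
  have [|y yx ye] := @xgetPex _ 0%N
    [set e | exists2 x', an_fiber (cover_mor F') x x' & ram_index (cover_mor F') x x' e].
    have Iy := typeI_fiber _ q0x'.
    have [e he] := exists_ram_index Iy (eq_ind_r (@type_I _ _ _ _) Ix q0x').
    by rewrite q0x' in he; exists e, (anmap b q0).
  by exists y, (ram (cover_mor F') x).
have Iy := typeI_fiber _ yx.
rewrite {}ramE.
(* The chosen [y] must be lifted to the curve of [K], because [psi'] is described only through
   [psi'']. *)
have [t0 ty] : exists t, y = galact t (anmap b q0).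
  by apply: (galact_trans galF'); rewrite q0x' -yx.
have [s0 s0E] := gal_lift hab t0.
have lift_act (t : gal_of {:F'}%AS) (s : gal_of {:K}%AS)
    (q : anpoint abs (cover_curve K)) : (forall z : F', s (b z) = b (t z)) ->
    galact t (anmap b q) = anmap b (galact s q).
  by move=> E; apply: anpoint_eq; apply/funext => f /=; rewrite E.
set q1 := galact s0 q0.
have yE : y = anmap b q1 by rewrite ty (lift_act _ _ _ s0E).
have equi t : psi' r (galact t y) = galact t (psi' r y).
  have [s sE] := gal_lift hab t.
  rewrite yE (lift_act _ _ _ sE) !hpsi'.2 // (lift_act _ _ _ sE).
  rewrite (@lift_equivariant X K (comp_mor (comp_mor a (cover_mor F')) b) hab
    Sigma lam psi'' hpsi'') //.
set q := psi' r y.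
have qE : anmap (cover_mor F') q = psi r x.
  rewrite /q yE hpsi'.2 //.
  have -> : x = anmap (comp_mor (cover_mor F') b) q1.
    by rewrite -yx yE; apply: anpoint_eq.
  by rewrite hpsi.2 //; apply: anpoint_eq.
pose D := [set s | galact s q == q]%SET.
rewrite -(card_fiber galF' q) qE; congr (_ * _)%N.
have ye' : ram_index (cover_mor F') (anmap (cover_mor F') y) y e by rewrite yx.
have Ix' : type_I (anmap (cover_mor F') y) by rewrite yx.
have stabE := card_stab galF' Iy ye' Ix'.
suff cE y' : an_fiber (cover_mor F') x y' ->
    (set_card [set y1 | [/\ type_I y1, an_fiber (cover_mor F') x y1 &
       psi' r y1 = psi' r y']] * e)%N = #|D|.
  have [|y' y'x nE] := @xgetPex _ 0%N [set n | exists2 x', an_fiber (cover_mor F') x x' &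
      n = set_card [set y' | [/\ type_I y', an_fiber (cover_mor F') x y' &
                                 psi' r y' = psi' r x']]].
    by eexists; exists y.
  by rewrite /c_ nE cE.
move=> y'x; have [t tE] : exists t, y' = galact t y.
  by apply: (galact_trans galF'); rewrite y'x.
(* By equivariance, this coset of the stabilizer of [q] consists of the [s] for which [galact s y]
   and [y'] have the same image under [psi' r]. *)
pose A := [set s | galact s q == galact t q]%SET.
have -> : [set y1 | [/\ type_I y1, an_fiber (cover_mor F') x y1 &
    psi' r y1 = psi' r y']] = (fun s => galact s y) @` [set` A].
  apply/seteqP; split=> y1 /=.
    move=> [Iy1 y1x y1E]; have [s sE] : exists s, y1 = galact s y.
      by apply: (galact_trans galF'); rewrite y1x.
    by exists s => //=; rewrite inE -!equi -sE -tE y1E.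
  move=> [s /=]; rewrite inE => /eqP sA <-.
  have sx : an_fiber (cover_mor F') x (galact s y).
    by rewrite /an_fiber /= anmap_galact.
  by split; [exact: typeI_fiber|exact: sx|rewrite tE !equi].
rewrite -[RHS](card_same_image q t); apply: set_card_image => s sA.
(* If [s'] and [s] move [y] to the same point, then [s'] is in [A]; the fibres over [A] are thus
   full cosets of the stabilizer of [y], of order [e]. *)
rewrite -stabE -[RHS](card_same_image y s); apply: eq_card => s'.
rewrite !inE andb_idl // => /eqP E; rewrite inE in sA.
by rewrite -equi E equi.
Qed.

End Points.

Theorem proposition5p10
  (R : realType) (k : closedFieldType) (abs : k -> R)
  (habs : nontrivial_complete abs)
  (* phi : C' -> C, with k(C') = F' Galois over k(C) *)
  (C : curve k) (F' : splittingFieldType C)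
  (galF' : galois 1%VS {:F'}%VS)
  (* a : C -> P^1, and K Galois over k(P^1) containing k(C') *)
  (a : curve_mor C (P1 k))
  (K : splittingFieldType (P1 k)) (galK : galois 1%VS {:K}%VS)
  (b : curve_mor (cover_curve K) (cover_curve F'))
  (hab : forall z : P1 k, b (cover_mor F' (a z)) = cover_mor K z)
  (A : set (anpoint abs (P1 k)))
  (hA : P1_vertex_set a (cover_mor F') b A)
  (lam : R -> anpoint abs (P1 k) -> anpoint abs (P1 k))
  (hlam : P1_retraction (skeleton A) lam)
  (psi'' : R -> anpoint abs (cover_curve K) -> anpoint abs (cover_curve K))
  (hpsi'' : lifted_retraction (comp_mor (comp_mor a (cover_mor F')) b)
              (skeleton A) lam psi'')
  (psi' : R -> anpoint abs (cover_curve F') -> anpoint abs (cover_curve F'))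
  (hpsi' : induced_retraction b
             (anmap (comp_mor a (cover_mor F')) @^-1` skeleton A) psi'' psi')
  (psi : R -> anpoint abs C -> anpoint abs C)
  (hpsi : induced_retraction (comp_mor (cover_mor F') b)
            (anmap a @^-1` skeleton A) psi'' psi)
  (p : anpoint abs C) (hp : ~ type_IV p)
  (r : R) (hr : is_radius psi p r)
  (x : anpoint abs C) (hx : type_I x) (hxp : psi r x = p) :
  (n_ (cover_mor F') p)%:R =
    (\dim {:F'})%:R / ((c_ (cover_mor F') psi' r x)%:R * (ram (cover_mor F') x)%:R)
    :> rat.
Proof.
have [r01 _ _] := hr.
have count := galois_fiber_count habs galF' hab hpsi'' hpsi' hpsi r01 hx.
have : (0 < \dim {:F'})%N by rewrite adim_gt0.
rewrite -count hxp muln_gt0 => /andP[_]; rewrite lt0n => cr0.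
by rewrite -natrM natrM mulfK // pnatr_eq0.
Qed.
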